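(* Let $q$ be a power of an odd prime and let $G=\mathbf{PGL}(2,q)$, with conjugacy classes $\mathcal{C}_1,\dots,\mathcal{C}_6$ and representatives as listed in the context. Then the class $\mathcal{C}_2$ is of type B. Moreover, the following conditions hold, where in each case $\rho$ is an irreducible representation over $k$ of the centralizer in $G$ of the given representative of the class: (i) Let $q\equiv 1\pmod 4$ and let $\mathcal{C}_3$ be the class of $c_3(x)$. If $\dim\mathfrak{B}(\mathcal{C}_3,\rho)<\infty$, then $x$ has even order (in $\mathbb{F}_q^\times$) and $\rho(c_3(x))=-1$. (ii) Let $q\equiv 3\pmod 4$ and let $\chi$ be the character of $\rho$, a representation of $C_G(c_4)\simeq\mathbb{D}_{q-1}$. If $\dim\mathfrak{B}(\mathcal{C}_4,\rho)<\infty$, then $\chi\in\{\chi_3,\chi_4\}\cup\{\mu_h : h\text{ odd}\}$, where the characters are those of $\mathbb{D}_{q-1}$. (iii) Let $q\equiv 3\pmod 4$ and let $\mathcal{C}_5$ be the class of $c_5(z)$. If $\dim\mathfrak{B}(\mathcal{C}_5,\rho)<\infty$, then $c_5(z)$ has even order and $\rho(c_5(z))=-1$. (iv) Let $q\equiv 1\pmod 4$ and let $\chi$ be the character of $\rho$, a representation of $C_G(c_6)\simeq\mathbb{D}_{q+1}$. If $\dim\mathfrak{B}(\mathcal{C}_6,\rho)<\infty$, then $\chi\in\{\chi_3,\chi_4\}\cup\{\mu_h : h\text{ odd}\}$, where the characters are those of $\mathbb{D}_{q+1}$.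
   Context: $k$ is an algebraically closed field of characteristic zero. Let $G$ be a finite group, $g\in G$, $\mathcal{C}=\{xgx^{-1}:x\in G\}$ its conjugacy class, $C_G(g)$ the centralizer of $g$, and $\rho:C_G(g)\to \mathbf{GL}(V)$ an irreducible (finite-dimensional) representation over $k$. The associated Yetter-Drinfeld module is $M(\mathcal{C},\rho)=kG\otimes_{kC_G(g)}V$, with $G$ acting by left multiplication on the first factor and with coaction $x\otimes v\mapsto xgx^{-1}\otimes(x\otimes v)$ for $x\in G$, $v\in V$. It is a braided vector space with braiding $c\big((x\otimes v)\otimes(y\otimes w)\big)=\big(xgx^{-1}y\otimes w\big)\otimes(x\otimes v)$. $\mathfrak{B}(\mathcal{C},\rho)$ denotes the Nichols algebra of this braided vector space, i.e. the quotient of the tensor algebra of $M(\mathcal{C},\rho)$ by the direct sum over $n\geq 2$ of the kernels of the quantum symmetrizers of degree $n$. Since $g$ is central in $C_G(g)$, $\rho(g)$ is a scalar; $\rho(g)=-1$ means that it is the scalar $-1$. Definition (type B). The conjugacy class $\mathcal{C}$ of $g$ in $G$ is of type B if for every irreducible representation $\rho$ of $C_G(g)$ the Nichols algebra $\mathfrak{B}(\mathcal{C},\rho)$ is infinite dimensional. Classes of $\mathbf{PGL}(2,q)=\mathbf{GL}(2,\mathbb{F}_q)/\{tI:t\in\mathbb{F}_q^\times\}$. Fix $\Delta\in\mathbb{F}_q$ a non-square, and $\delta\in E=\mathbb{F}_{q^2}$ with $\delta^2=\Delta$; elements of $E$ are written $z=x+\delta y$ with $x,y\in\mathbb{F}_q$.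 The conjugacy classes are those of (the images in $\mathbf{PGL}(2,q)$ of) the following matrices, where $\mathcal{C}_i$ denotes the class of $c_i$ (for $i=3,5$ a family of classes, one for each admissible parameter up to conjugacy): $c_1=\begin{pmatrix}1&0\\0&1\end{pmatrix}$; $c_2=\begin{pmatrix}1&1\\0&1\end{pmatrix}$; $c_3(x)=\begin{pmatrix}x&0\\0&1\end{pmatrix}$ with $x\in\mathbb{F}_q^\times$, $x\neq\pm1$; $c_4=\begin{pmatrix}-1&0\\0&1\end{pmatrix}$; $c_5(z)=\begin{pmatrix}x&\Delta y\\ y&x\end{pmatrix}$ with $z=x+\delta y$, $xy\neq0$; $c_6=\begin{pmatrix}0&\Delta\\1&0\end{pmatrix}$. Dihedral groups. $\mathbb{D}_n$ is the group of order $2n$ generated by $r,s$ with relations $r^n=s^2=1$, $srs=r^{-1}$. For $n$ even its irreducible characters are, on the elements $r^j$ and $sr^j$: $\chi_1$: $1$, $1$; $\chi_2$: $1$, $-1$; $\chi_3$: $(-1)^j$, $(-1)^j$; $\chi_4$: $(-1)^j$, $(-1)^{j+1}$ (all of degree $1$); and $\mu_h$ for $0<h<\frac n2$, of degree $2$: $2\cos\frac{2\pi hj}{n}$, $0$. (The values are regarded in $k$ in the usual way.) The centralizer of $c_4$ in $\mathbf{PGL}(2,q)$ is identified with $\mathbb{D}_{q-1}$ by an isomorphism sending $c_4$ to $r^{(q-1)/2}$, and the centralizer of $c_6$ is identified with $\mathbb{D}_{q+1}$ by an isomorphism sending $c_6$ to $r^{(q+1)/2}$. *)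

(* Defs.v *)
From HB Require Import structures.
From mathcomp Require Import all_boot all_order all_algebra.
From mathcomp Require Import all_fingroup all_solvable all_field all_character.
From mathcomp Require Import ring_quotient finmap.
From mathcomp.multinomials Require Import monalg.

Set Implicit Arguments.
Unset Strict Implicit.
Unset Printing Implicit Defensive.

Import GRing.Theory.
Local Open Scope ring_scope.

Definition finite_dimensional (k : fieldType) (V : lmodType k) : Prop :=
  exists s : seq V, forall v : V,
  exists a : 'I_(size s) -> k, v = \sum_i a i *: s`_i.

(* Matsumoto section: for s in the symmetric group of 'I_n, a reduced         *)
(* expression of s in the adjacent transpositions. A transposition            *)
(* (p, p.+1) is encoded by the pair of its two positions; the word            *)
(* [:: w1; ..; wl] stands for the composite function w1 \o .. \o wl.          *)

Section ReducedWords.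

Variable n : nat.
Implicit Types (s : 'S_n) (p : 'I_n * 'I_n).

Definition inversions s : {set 'I_n * 'I_n} :=
  [set p : 'I_n * 'I_n | (p.1 < p.2)%N && (s p.2 < s p.1)%N].

Definition adjacent p : bool := p.2 == p.1.+1 :> nat.

Definition descent s p := adjacent p && (s p.2 < s p.1)%N.

Definition last_descent s : option ('I_n * 'I_n) :=
  [pick p | descent s p & [forall p', descent s p' ==> (p'.1 <= p.1)%N]].

Fixpoint sorting_word (m : nat) s : seq ('I_n * 'I_n) :=
  if m is m'.+1 then
    if last_descent s is Some p then
      rcons (sorting_word m' (tperm p.1 p.2 * s)%g) p
    else [::]
  else [::].

Definition reduced_word s := sorting_word #|inversions s| s.

(* MathComp permutations multiply from left to right: (s * t) i = t (s i).    *)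
Definition word_perm (w : seq ('I_n * 'I_n)) : 'S_n :=
  foldr (fun p s => s * tperm p.1 p.2)%g 1%g w.

Lemma reduced_word_adjacent s : all adjacent (reduced_word s).
Proof.
rewrite /reduced_word; move: #|_| => m; elim: m s => //= m IH s.
rewrite /last_descent; case: pickP => //= p /andP[/andP[ap _] _].
by rewrite all_rcons ap IH.
Qed.

Lemma ninv_descent s p : descent s p ->
  #|inversions s| = #|inversions (tperm p.1 p.2 * s)%g|.+1.
Proof.
case: p => i i' /andP[/eqP /= ii' lt_s].
have ne : i != i' by rewrite -val_eqE /= ii' neq_ltn ltnSn.
set t := tperm i i'.
have mono (a b : 'I_n) : (a, b) != (i, i') -> (a < b -> t a < t b)%N.
  move=> nab lt_ab; rewrite /t !permE /=.
  have [Ea|na] := eqVneq a i; have [Eb|nb] := eqVneq b i.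
  - by move: lt_ab; rewrite Ea Eb ltnn.
  - have [Eb'|nb'] := eqVneq b i'; first by rewrite Ea Eb' eqxx in nab.
    move: lt_ab; rewrite Ea -ii' leq_eqVlt => /orP[/eqP/val_inj Eb'|//].
    by rewrite -Eb' eqxx in nb'.
  - have [Ea'|na'] := eqVneq a i'.
      by move: lt_ab; rewrite Ea' Eb ii' ltnNge leqnSn.
    by rewrite ii' -Eb ltnS ltnW.
  have [Ea'|na'] := eqVneq a i'; have [Eb'|nb'] := eqVneq b i'.
  - by move: lt_ab; rewrite Ea' Eb' ltnn.
  - by apply: ltn_trans lt_ab; rewrite Ea' ii'.
  - move: lt_ab; rewrite Eb' ii' ltnS leq_eqVlt => /orP[/eqP/val_inj Ea|//].
    by rewrite Ea eqxx in na.
  - by [].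
pose f p : 'I_n * 'I_n := (t p.1, t p.2).
have fK : involutive f by case=> a b; rewrite /f /= !tpermK.
have -> : inversions s = (i, i') |: f @: inversions (t * s)%g.
  apply/setP=> -[a b]; rewrite !inE.
  have [->|nab] /= := eqVneq (a, b) (i, i'); first by rewrite ii' ltnSn lt_s.
  rewrite -[(a, b)]fK (mem_imset _ _ (inv_inj fK)) inE /= !permM !tpermK.
  case: (boolP (s b < s a)%N) => sab; rewrite ?andbF // !andbT.
  apply/idP/idP; first exact: mono.
  move=> lt; have := @mono (t a) (t b); rewrite !tpermK; apply=> //.
  apply/eqP=> -[Ea Eb]; move: sab.
  have -> : a = i' by rewrite -[a](tpermK i i') -/t Ea /t tpermL.
  have -> : b = i by rewrite -[b](tpermK i i') -/t Eb /t tpermR.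
  by rewrite ltnNge (ltnW lt_s).
rewrite cardsU1 card_imset; last exact: inv_inj fK.
rewrite -[(i, i')]fK (mem_imset _ _ (inv_inj fK)) inE /= /t tpermL tpermR.
by rewrite ii' ltnNge leqnSn.
Qed.

Lemma last_descentN s : last_descent s = None -> s = 1%g.
Proof.
rewrite /last_descent; case: pickP => // nod _.
have nd p : descent s p = false.
  apply/negP => dp.
  case: (arg_maxnP (fun p : 'I_n * 'I_n => val p.1) dp) => p0 dp0 max0.
  have /negP[] := nod p0; rewrite /= dp0 /=; apply/forallP => p'.
  by apply/implyP => /max0.
have step (i i' : 'I_n) : i' = i.+1 :> nat -> (s i < s i')%N.
  move=> ii'; have := nd (i, i'); rewrite /descent /adjacent /= ii' eqxx /=.
  move/negbT; rewrite -leqNgt leq_eqVlt => /orP[/eqP/val_inj/perm_inj Ei|//].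
  by move/eqP: ii'; rewrite Ei -[X in X == _]addn0 -addn1 eqn_add2l.
have ge_id (m : nat) (i : 'I_n) : val i = m -> (m <= s i)%N.
  elim: m i => // m IH i im.
  have lt_m : (m < n)%N by apply: leq_trans (ltn_ord i); rewrite -im; exact: ltnW.
  apply: leq_ltn_trans (IH (Ordinal lt_m) erefl) _.
  by apply: step; rewrite /= -im.
have le_id (m : nat) (i : 'I_n) : (i + m).+1 = n -> (s i <= i)%N.
  elim: m i => [|m IH] i im.
    by rewrite -ltnS; apply: leq_trans (ltn_ord _) (eq_leq (esym _)); rewrite -[in LHS](addn0 i).
  have lt_i : (i.+1 < n)%N by apply: leq_trans (eq_leq im); rewrite ltnS addnS ltnS leq_addr.
  rewrite -ltnS; apply: leq_trans (step i (Ordinal lt_i) erefl) _.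
  by apply: (IH (Ordinal lt_i)); rewrite /= addSn -addnS.
apply/permP=> i; rewrite perm1; apply/val_inj/eqP; rewrite eqn_leq.
rewrite (ge_id _ i erefl) andbT; apply: (le_id (n - i.+1)%N).
by rewrite -addSn subnKC.
Qed.

Lemma last_descentS s p : last_descent s = Some p -> descent s p.
Proof. by rewrite /last_descent; case: pickP => // q /andP[dq _] [<-]. Qed.

Lemma word_perm_rcons w p :
  word_perm (rcons w p) = (tperm p.1 p.2 * word_perm w)%g.
Proof.
by elim: w => [|q w IH] /=; rewrite ?mulg1 ?mul1g // -/(word_perm _) IH mulgA.
Qed.

Lemma inversions1 : inversions 1%g = set0.
Proof.
apply/setP=> p; rewrite !inE !perm1; apply/negP => /andP[lt1 lt2].
by have := ltn_trans lt1 lt2; rewrite ltnn.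
Qed.

Lemma reduced_wordP s :
  word_perm (reduced_word s) = s /\ size (reduced_word s) = #|inversions s|.
Proof.
rewrite /reduced_word; move Em: #|inversions s| => m.
elim: m s Em => [|m IH] s Em /=.
  split=> //; case E: (last_descent s) => [p|]; last by rewrite (last_descentN E).
  by have := ninv_descent (last_descentS E); rewrite Em.
case E: (last_descent s) => [p|]; last first.
  by move: Em; rewrite (last_descentN E) inversions1 cards0.
have /esym/eqP := ninv_descent (last_descentS E).
rewrite Em eqSS => /eqP/IH[wp sz].
by rewrite word_perm_rcons wp size_rcons sz mulgA tperm2 mul1g.
Qed.

End ReducedWords.

(* A finite-dimensional braided vector space is given by a basis indexed by a *)
(* finite type B and a linear braiding c on V (x) V, where V = k^B and        *)
(* V^{(x) n} = k^{B^n}.                                                       *)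

Section Nichols.

Variables (k : fieldType) (B : finType).

Definition tensor2 (u v : {ffun B -> k^o}) : {ffun B * B -> k^o} :=
  [ffun ab => u ab.1 * v ab.2].

Definition tensor_power n := {ffun n.-tuple B -> k^o}.

Variable c : {linear {ffun B * B -> k^o} -> {ffun B * B -> k^o}}.

Definition subst2 n (w : n.-tuple B) (p : 'I_n * 'I_n) (ab : B * B) :
    n.-tuple B :=
  [tuple if i == p.1 then ab.1 else if i == p.2 then ab.2 else tnth w i
    | i < n].

(* id (x) c (x) id, acting on the tensor factors p.1 and p.2.                 *)
Definition braid_at n (p : 'I_n * 'I_n) (t : tensor_power n) : tensor_power n :=
  [ffun w => c [ffun ab => t (subst2 w p ab)] (tnth w p.1, tnth w p.2)].

Definition braid_word n (w : seq ('I_n * 'I_n)) (t : tensor_power n) :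
    tensor_power n :=
  foldr (@braid_at n) t w.

Definition quantum_symmetrizer n (t : tensor_power n) : tensor_power n :=
  \sum_(s : 'S_n) braid_word (reduced_word s) t.

(* The tensor algebra T(V) is the free algebra on B.                          *)
Definition tensor_algebra := {malg k[{fmonom B}]}.

Definition component n (t : tensor_algebra) : tensor_power n :=
  [ffun w : n.-tuple B => t@_(FMonom w)].

Definition nichols_ideal : {pred tensor_algebra} :=
  [pred t : tensor_algebra |
    all (fun m : {fmonom B} =>
           quantum_symmetrizer (component (size m) t) == 0) (msupp t)].

Lemma component_is_linear n : linear (@component n).
Proof. by move=> a u v; apply/ffunP=> w; rewrite !ffunE mcoeffD mcoeffZ. Qed.

HB.instance Definition _ n :=
  GRing.isLinear.Build k tensor_algebra (tensor_power n) _ (@component n)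
    (@component_is_linear n).

Lemma braid_at_is_linear n p : linear (@braid_at n p).
Proof.
move=> a u v; apply/ffunP=> w; rewrite !ffunE.
have -> : [ffun ab => (a *: u + v) (subst2 w p ab)] =
    a *: [ffun ab => u (subst2 w p ab)] + [ffun ab => v (subst2 w p ab)]
    :> {ffun B * B -> k^o}.
  by apply/ffunP=> ab; rewrite !ffunE.
by rewrite linearP !ffunE.
Qed.

Lemma braid_word_is_linear n w : linear (@braid_word n w).
Proof.
by move=> a u v; elim: w => //= p w ->; rewrite (braid_at_is_linear p).
Qed.

Lemma quantum_symmetrizer_is_linear n : linear (@quantum_symmetrizer n).
Proof.
move=> a u v; rewrite /quantum_symmetrizer scaler_sumr -big_split /=.
by apply: eq_bigr => s _; rewrite braid_word_is_linear.
Qed.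

HB.instance Definition _ n :=
  GRing.isLinear.Build k (tensor_power n) (tensor_power n) _
    (@quantum_symmetrizer n) (@quantum_symmetrizer_is_linear n).

Lemma quantum_symmetrizer_small n t : (n < 2)%N ->
  @quantum_symmetrizer n t = t.
Proof.
move=> n_lt2; rewrite /quantum_symmetrizer (bigD1 1%g) //= big1 => [|s /eqP[]].
  by rewrite addr0 /reduced_word inversions1 cards0.
apply/permP=> i; rewrite perm1; apply/val_inj => /=.
by move: (ltn_ord i) (ltn_ord (s i)); case: n n_lt2 s i {t} => [|[]] //= _ s;
   case=> [[|//] lt0]; case: (s _) => [[]].
Qed.

Lemma nichols_idealP t : reflect
  (forall n, quantum_symmetrizer (component n t) = 0) (t \in nichols_ideal).
Proof.
apply: (iffP allP) => [kt n | kt m _]; last by rewrite kt.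
have [w tw|t0] := pickP (fun w : n.-tuple B => t@_(FMonom w) != 0).
  by have := kt (FMonom w); rewrite -mcoeff_neq0 tw /= size_tuple => /(_ isT)/eqP.
suff -> : component n t = 0 by rewrite linear0.
by apply/ffunP=> w; rewrite !ffunE; apply/eqP/negPn; rewrite t0.
Qed.

Lemma nichols_idealE t : t \in nichols_ideal <->
  [/\ component 0 t = 0, component 1 t = 0 &
      forall n, (2 <= n)%N -> quantum_symmetrizer (component n t) = 0].
Proof.
split=> [/nichols_idealP kt|[t0 t1 kt]].
  split=> [||n _]; last exact: kt.
    by rewrite -[component _ _]quantum_symmetrizer_small.
  by rewrite -[component _ _]quantum_symmetrizer_small.
by apply/nichols_idealP => -[|[|n]]; rewrite ?t0 ?t1 ?linear0 ?kt.
Qed.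

Lemma nichols_ideal_submod : submod_closed nichols_ideal.
Proof.
split=> [|a u v /nichols_idealP ku /nichols_idealP kv]; apply/nichols_idealP => n.
  by rewrite !linear0.
by rewrite !linearP /= ku kv scaler0 addr0.
Qed.

HB.instance Definition _ :=
  GRing.isSubmodClosed.Build k tensor_algebra nichols_ideal
    nichols_ideal_submod.

(* Only the vector space structure of the quotient is recorded: it is all     *)
(* that the dimension depends on.                                             *)
Definition nichols_algebra : Type := {ideal_quot nichols_ideal}.

HB.instance Definition _ := GRing.Zmodule.on nichols_algebra.

Definition nichols_class (t : tensor_algebra) : nichols_algebra :=
  (\pi_({ideal_quot nichols_ideal}) t)%qT.

Definition nichols_scale (a : k) (x : nichols_algebra) : nichols_algebra :=
  nichols_class (a *: generic_quotient.repr (x : {ideal_quot nichols_ideal})).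

Lemma nichols_class_eq t u :
  (nichols_class t == nichols_class u) = (t - u \in nichols_ideal).
Proof. by rewrite Quotient.idealrBE. Qed.

Lemma nichols_classP x : exists t, x = nichols_class t.
Proof. by exists (generic_quotient.repr (x : {ideal_quot nichols_ideal})); rewrite /nichols_class reprK. Qed.

Lemma nichols_classD t u :
  nichols_class (t + u) = nichols_class t + nichols_class u.
Proof. exact: raddfD. Qed.

Lemma nichols_classZ a t :
  nichols_class (a *: t) = nichols_scale a (nichols_class t).
Proof.
apply/eqP; rewrite nichols_class_eq -scalerBr rpredZ //.
by rewrite -nichols_class_eq /nichols_class reprK.
Qed.

Lemma nichols_scaleA a b x :
  nichols_scale a (nichols_scale b x) = nichols_scale (a * b) x.
Proof. by have [t ->] := nichols_classP x; rewrite -!nichols_classZ scalerA. Qed.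

Lemma nichols_scale1 : left_id 1 nichols_scale.
Proof.
by move=> x; have [t ->] := nichols_classP x; rewrite -nichols_classZ scale1r.
Qed.

Lemma nichols_scaleDr : right_distributive nichols_scale +%R.
Proof.
move=> a x y; have [t ->] := nichols_classP x; have [u ->] := nichols_classP y.
by rewrite -nichols_classD -!nichols_classZ -nichols_classD scalerDr.
Qed.

Lemma nichols_scaleDl x :
  {morph nichols_scale^~ x : a b / a + b}.
Proof.
move=> a b; have [t ->] := nichols_classP x.
by rewrite -!nichols_classZ -nichols_classD scalerDl.
Qed.

HB.instance Definition _ := GRing.Zmodule_isLmodule.Build k nichols_algebra
  nichols_scaleA nichols_scale1 nichols_scaleDr nichols_scaleDl.

Lemma nichols_class_is_linear : linear nichols_class.
Proof. by move=> a t u; rewrite nichols_classD nichols_classZ. Qed.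

HB.instance Definition _ := GRing.isLinear.Build k tensor_algebra
  nichols_algebra _ nichols_class nichols_class_is_linear.

End Nichols.

(* M(C, rho) = kG (x)_{kH} V for H = 'C_G[g] and V = k^d, with x in H acting  *)
(* on column vectors by v |-> rho x *m v. Choosing the representative repr X  *)
(* of each left coset X of H in G, the tensors repr X (x) e_i form a basis.   *)
(* mx_irreducible refers to the row action u |-> u *m rho x; taking           *)
(* annihilators shows that it is equivalent to irreducibility on columns.     *)

Section YetterDrinfeld.

Variables (k : fieldType) (gT : finGroupType) (G : {group gT}) (g : gT).
Variables (d : nat) (rho : mx_representation k 'C_G[g] d).

Definition yd_basis : finType :=
  ({X : {set gT} | X \in lcosets 'C_G[g] G} * 'I_d)%type.

(* The tensor x (x) v: if x is in X then x = repr X * h with h in H, and      *)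
(* x (x) v = repr X (x) rho h v.                                              *)
Definition yd_tensor (x : gT) (v : 'cV[k]_d) : {ffun yd_basis -> k^o} :=
  [ffun b : yd_basis => let X := val b.1 in
    if x \in X then (rho ((repr X)^-1 * x)%g *m v) b.2 0 else 0].

Definition yd_rep (b : yd_basis) : gT := repr (val b.1).

Definition yd_vec (b : yd_basis) : 'cV[k]_d := delta_mx b.2 0.

Definition yd_braiding (t : {ffun yd_basis * yd_basis -> k^o}) :
    {ffun yd_basis * yd_basis -> k^o} :=
  \sum_(ab : yd_basis * yd_basis)
    t ab *: let x := yd_rep ab.1 in let y := yd_rep ab.2 in
      tensor2 (yd_tensor (x * g * x^-1 * y)%g (yd_vec ab.2))
              (yd_tensor x (yd_vec ab.1)).

Lemma yd_braiding_is_linear : linear yd_braiding.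
Proof.
move=> a u v; rewrite /yd_braiding scaler_sumr -big_split /=.
by apply: eq_bigr => ab _; rewrite !ffunE scalerDl scalerA.
Qed.

HB.instance Definition _ := GRing.isLinear.Build k
  {ffun yd_basis * yd_basis -> k^o} {ffun yd_basis * yd_basis -> k^o} _
  yd_braiding yd_braiding_is_linear.

Lemma yd_rep_mem (b : yd_basis) : yd_rep b \in val b.1.
Proof.
rewrite /yd_rep; case: b => [[X /= /lcosetsP[x _ ->]] i] /=.
exact: mem_repr (lcoset_refl _ x).
Qed.

Lemma yd_basis_mem (b : yd_basis) x :
  (x \in val b.1) = ((yd_rep b)^-1 * x \in 'C_G[g])%g.
Proof.
have := yd_rep_mem b; rewrite /yd_rep; case: b => [[X /= XG] i] /=.
case/lcosetsP: XG => y _ -> /lcoset_eqP E.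
by rewrite -mem_lcoset E.
Qed.

Lemma yd_basis_val (b : yd_basis) : val b.1 = (yd_rep b *: 'C_G[g])%g.
Proof. by apply/setP=> x; rewrite yd_basis_mem mem_lcoset. Qed.

Lemma yd_rep_in (b : yd_basis) : yd_rep b \in G.
Proof.
have := yd_rep_mem b; rewrite /yd_rep; move: (repr _) => r.
case: b => [[X /= XG] i] /=; case/lcosetsP: XG => y Gy ->.
case/lcosetP=> h Hh ->; rewrite groupM //; by case/setIP: Hh.
Qed.

Lemma yd_tensor_is_linear x : linear (yd_tensor x).
Proof.
move=> a u v; apply/ffunP=> b; rewrite !ffunE /=.
by case: ifP => _; rewrite ?mulmxDr -?scalemxAr ?mxE // scaler0 addr0.
Qed.

HB.instance Definition _ x := GRing.isLinear.Build k 'cV[k]_d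
  {ffun yd_basis -> k^o} _ (yd_tensor x) (yd_tensor_is_linear x).

Lemma yd_tensor_balanced x h v : h \in ('C_G[g])%g ->
  yd_tensor (x * h)%g v = yd_tensor x (rho h *m v).
Proof.
move=> Hh; apply/ffunP=> b; rewrite !ffunE /= !yd_basis_mem mulgA groupMr //.
by case: ifP => // Hr; rewrite -/(yd_rep b) repr_mxM // mulmxA.
Qed.

Lemma yd_tensor_basis (b : yd_basis) :
  yd_tensor (yd_rep b) (yd_vec b) = [ffun b' => (b' == b)%:R].
Proof.
apply/ffunP=> b'; rewrite !ffunE /=.
have [/= Eb|nb] := eqVneq b'.1 b.1.
  rewrite Eb yd_rep_mem -/(yd_rep b) mulVg repr_mx1 mul1mx mxE eqxx andbT.
  by congr (_%:R : k); case: b b' Eb => ? ? [? ?] /= ->; rewrite xpair_eqE eqxx.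
rewrite [b' == b](negPf _); last by apply: contra nb => /eqP->.
case: ifP => // rb; case/eqP: nb; apply/val_inj; move: rb.
by rewrite /= !yd_basis_val => /lcoset_eqP.
Qed.

Lemma yd_tensor_expand z y w : y \in G ->
  \sum_b yd_tensor y w b *: yd_tensor (z * yd_rep b)%g (yd_vec b) =
  yd_tensor (z * y)%g w.
Proof.
move=> Gy; have XG : (y *: 'C_G[g])%g \in lcosets 'C_G[g] G.
  by apply/lcosetsP; exists y.
pose X : {X : {set gT} | X \in lcosets 'C_G[g] G} := Sub (y *: 'C_G[g])%g XG.
pose F (b : yd_basis) :=
  yd_tensor y w b *: yd_tensor (z * yd_rep b)%g (yd_vec b).
have -> : \sum_b F b = \sum_Y \sum_i F (Y, i).
  by rewrite pair_bigA; apply: eq_bigr => -[].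
rewrite (bigD1 X) //= {}/F.
rewrite [X in _ + X]big1 ?addr0 => [|Y nYX]; last first.
  apply: big1 => i _; rewrite ffunE /= ifF ?scale0r //.
  apply: contraNF nYX; case: Y => Y /= YG; rewrite -val_eqE /=.
  by case/lcosetsP: YG => u _ -> /lcoset_eqP ->.
set r := repr (y *: 'C_G[g])%g.
have ry : (r^-1 * y \in 'C_G[g])%g.
  rewrite -mem_lcoset; suff /lcoset_eqP -> : r \in (y *: 'C_G[g])%g.
    exact: lcoset_refl.
  exact: mem_repr (lcoset_refl _ y).
have -> : (z * y = z * r * (r^-1 * y))%g by rewrite -mulgA mulKVg.
rewrite yd_tensor_balanced // [in RHS](matrix_sum_delta (_ *m _)) linear_sum /=.
apply: eq_bigr => i _; rewrite big_ord1 linearZ /=; congr (_ *: _).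
by rewrite ffunE /= lcoset_refl.
Qed.

Lemma tensor2_sum (I J : finType) (a : I -> k) (b : J -> k)
    (u : I -> {ffun yd_basis -> k^o}) (v : J -> {ffun yd_basis -> k^o}) :
  tensor2 (\sum_j b j *: v j) (\sum_i a i *: u i) =
  \sum_i \sum_j (a i * b j) *: tensor2 (v j) (u i).
Proof.
apply/ffunP=> -[x y]; rewrite ffunE /= !sum_ffunE.
under [RHS]eq_bigr do rewrite sum_ffunE.
rewrite mulr_suml exchange_big /=; apply: eq_bigr => i _.
rewrite mulr_sumr; apply: eq_bigr => j _; rewrite !ffunE /=.
by rewrite /GRing.scale /= mulrACA [b i * _]mulrC.
Qed.

Lemma yd_braidingE x y v w : g \in G -> x \in G -> y \in G ->
  yd_braiding (tensor2 (yd_tensor x v) (yd_tensor y w)) =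
  tensor2 (yd_tensor (x * g * x^-1 * y)%g w) (yd_tensor x v).
Proof.
move=> Gg Gx Gy; rewrite -(yd_tensor_expand _ _ Gy).
have := yd_tensor_expand 1 v Gx; rewrite mul1g => Ex.
rewrite -[X in _ = tensor2 _ X]Ex tensor2_sum /yd_braiding pair_bigA /=.
apply: eq_bigr => -[a b] _ /=; rewrite mul1g ffunE /=.
have [ax|ax] := boolP (x \in val a.1); last first.
  by rewrite [yd_tensor x v a]ffunE /= (negPf ax) !mul0r !scale0r.
congr (_ *: tensor2 (yd_tensor (_ * _)%g _) _).
move: ax; rewrite yd_basis_mem => /setIP[_ /cent1P cg].
move: cg; rewrite /commute; set h := (_^-1 * x)%g => cg.
have -> : x = (yd_rep a * h)%g by rewrite mulKVg.
by move: h cg => h cg; rewrite invMg !mulgA -(mulgA _ h g) cg mulgA mulgK.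
Qed.

End YetterDrinfeld.

Definition nichols (k : fieldType) (gT : finGroupType) (G : {group gT})
    (g : gT) (d : nat) (rho : mx_representation k 'C_G[g] d) : lmodType k :=
  nichols_algebra (yd_braiding rho).

Definition type_B (k : fieldType) (gT : finGroupType) (G : {group gT})
    (g : gT) : Prop :=
  forall (d : nat) (rho : mx_representation k 'C_G[g] d),
    mx_irreducible rho -> ~ finite_dimensional (nichols rho).

Section PGL2.

Variable F : finFieldType.

Definition scalars : {set {'GL_2[F]}} := [set u | is_scalar_mx (GLval u)].

Lemma scalars_group_set : group_set scalars.
Proof.
apply/group_setP; split=> [|u v]; rewrite !inE ?GL_1E ?scalar_mx_is_scalar //.
by rewrite GL_MxE => /is_scalar_mxP[a ->] /is_scalar_mxP[b ->];
   rewrite -scalar_mxM scalar_mx_is_scalar.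
Qed.

Canonical scalars_group := Group scalars_group_set.

Definition PGL2 : {group coset_of scalars} := ('GL_2[F] / scalars)%G.

(* The class of A in PGL2; the default 1 is used only for singular A.         *)
Definition pgl (A : 'M[F]_2) : coset_of scalars :=
  coset scalars (insubd (1%g : {'GL_2[F]}) A).

Definition mx2 (a b c d : F) : 'M[F]_2 :=
  \matrix_(i, j) if i == 0 then (if j == 0 then a else b)
                 else (if j == 0 then c else d).

Definition pgl_c2 := pgl (mx2 1 1 0 1).
Definition pgl_c3 (x : F) := pgl (mx2 x 0 0 1).
Definition pgl_c4 := pgl (mx2 (-1) 0 0 1).
Definition pgl_c5 (D x y : F) := pgl (mx2 x (D * y) y x).
Definition pgl_c6 (D : F) := pgl (mx2 0 D 1 0).

Lemma scalars_norm (u : {'GL_2[F]}) : u \in 'N(scalars)%g.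
Proof.
apply: (subsetP (cent_sub _)); apply/centP => v; rewrite inE => /is_scalar_mxP[a E].
apply: val_inj; change (GLval u *m GLval v = GLval v *m GLval u).
by rewrite E scalar_mxC.
Qed.

Lemma det_mx2 a b c d : \det (mx2 a b c d) = a * d - b * c.
Proof.
rewrite (expand_det_row _ 0) !big_ord_recl big_ord0 addr0 /cofactor !det_mx11.
by rewrite !mxE /= expr0 expr1 mul1r mulN1r mulrN.
Qed.

Lemma pglM A B : A \in unitmx -> B \in unitmx ->
  pgl (A *m B) = (pgl A * pgl B)%g.
Proof.
move=> uA uB; rewrite /pgl -coset_morphM ?scalars_norm //; congr coset.
apply: val_inj; rewrite insubdK ?unitmx_mul ?uA //.
rewrite -[RHS]/(val (insubd _ A) *m val (insubd _ B)).
by rewrite !insubdK.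
Qed.

Lemma pgl_eq A B : A \in unitmx -> B \in unitmx ->
  pgl A = pgl B <-> exists2 t : F, t != 0 & B = t *: A.
Proof.
move=> uA uB; rewrite /pgl; set a := insubd _ A; set b := insubd _ B.
have Ea : GLval a = A by rewrite /a -[LHS]/(val _) insubdK.
have Eb : GLval b = B by rewrite /b -[LHS]/(val _) insubdK.
have cosE : coset scalars a = coset scalars b <-> (b * a^-1)%g \in scalars.
  split=> [E|sc]; first by rewrite coset_idr ?scalars_norm // coset_morphM
    ?scalars_norm // -E -coset_morphM ?scalars_norm // mulgV coset_id ?group1.
  apply/eqP; rewrite eq_sym eq_mulgV1 -morphV ?scalars_norm //=.
  by rewrite -coset_morphM ?scalars_norm // coset_id.
rewrite cosE inE GL_MxE GL_VxE Ea Eb; split=> [/is_scalar_mxP[t E]|[t t0 ->]].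
  have EB : B = t *: A by rewrite -[LHS](mulmxKV uA) E mul_scalar_mx.
  exists t => //; apply: contraTneq uB => t0.
  by rewrite EB t0 scale0r unitmxE det0 unitr0.
by rewrite -scalemxAl mulmxV // scalemx1 scalar_mx_is_scalar.
Qed.

Lemma pgl_in A : pgl A \in PGL2.
Proof. exact: mem_quotient. Qed.

Lemma unit_c2 : mx2 1 1 0 1 \in unitmx.
Proof. by rewrite unitmxE det_mx2 mulr0 subr0 mulr1 unitr1. Qed.

Lemma unit_c3 x : x != 0 -> mx2 x 0 0 1 \in unitmx.
Proof. by move=> x0; rewrite unitmxE det_mx2 mulr0 subr0 mulr1 unitfE. Qed.

Lemma unit_c4 : mx2 (-1) 0 0 1 \in unitmx.
Proof. by rewrite unit_c3 // oppr_eq0 oner_eq0. Qed.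

Lemma unit_c5 D x y : (forall a, a ^+ 2 != D) -> x * y != 0 ->
  mx2 x (D * y) y x \in unitmx.
Proof.
rewrite mulf_eq0 negb_or => nsq /andP[_ y0].
rewrite unitmxE det_mx2 unitfE subr_eq0; apply: contra (nsq (x / y)) => /eqP E.
by rewrite expr_div_n expr2 E -mulrA -expr2 mulfK // expf_neq0.
Qed.

Lemma unit_c6 D : (forall a, a ^+ 2 != D) -> mx2 0 D 1 0 \in unitmx.
Proof.
move=> nsq; rewrite unitmxE det_mx2 mul0r mulr1 sub0r unitfE oppr_eq0.
by have := nsq 0; rewrite expr0n eq_sym.
Qed.

End PGL2.

(* (r, s) is the image of the standard generators under an isomorphism from   *)
(* the dihedral group of order 2n onto D.                                     *)
Definition dihedral_generators (gT : finGroupType) (D : {set gT}) (n : nat)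
    (r s : gT) : Prop :=
  [/\ r ^+ n = 1, s ^+ 2 = 1, s * r * s = r^-1, <<[set r; s]>> = D
    & #|D| = n.*2]%g.

(* Functions on the dihedral group: chi e j is the value at s ^+ e * r ^+ j.  *)
Definition has_dihedral_character (k : fieldType) (gT : finGroupType) (d : nat)
    (rho : gT -> 'M[k]_d) (r s : gT) (chi : bool -> nat -> k) : Prop :=
  forall (e : bool) (j : nat), \tr (rho (s ^+ e * r ^+ j)%g) = chi e j.

Definition dihedral_chi3 (k : fieldType) (e : bool) (j : nat) : k :=
  (-1) ^+ j.

Definition dihedral_chi4 (k : fieldType) (e : bool) (j : nat) : k :=
  (-1) ^+ (j + e).

(* z is a primitive n-th root of unity, so that z ^+ i + z ^- i plays the     *)
(* role of 2 cos (2 pi i / n).                                                *)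
Definition dihedral_mu (k : fieldType) (z : k) (h : nat) (e : bool) (j : nat) :
    k :=
  if e then 0 else z ^+ (h * j) + z ^- (h * j).

(* Main.v *)
Require Import Defs.
From mathcomp Require Import all_boot all_order all_algebra.
From mathcomp Require Import all_fingroup all_solvable all_field all_character.
From mathcomp Require Import ring_quotient finmap.
From mathcomp.multinomials Require Import monalg.
From mathcomp Require Import ring zify.

Set Implicit Arguments.
Unset Strict Implicit.
Unset Printing Implicit Defensive.

Import GRing.Theory.
Local Open Scope ring_scope.

(** Everything rests on two small braided subspaces of M(C, rho), both of
diagonal type. By Schur's lemma rho(g) is a scalar l.

If l = 1, a basis vector x supported on a single coset satisfies
c(x (x) x) = x (x) x, so the quantum symmetrizer of degree n multiplies its n-th
power by n!, and the Nichols algebra is infinite dimensional in characteristic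
zero ([finite_dimensional_repr_neq1]).

If g is conjugate to its inverse by x and g is not an involution, basis vectors
x1 and x2 supported on the cosets of 1 and of x span a diagonal braided subspace
with q11 = q22 = l and q12 = q21 = l^-1. When l^2 <> 1 its generalized Dynkin
diagram is affine, of type A_1^(1), and the element y = x1 x2 - q12 x2 x1 belongs
to the imaginary root: its self-braiding q11 q12 q21 q22 is 1. The braided
derivations d1, d2 that strip letters from the left satisfy
d1 y = (1 - q12 q21) x2 and d2 y = 0, whence
d2 d1 (y^n) = n (1 - q12 q21) y^(n-1), and no power of y vanishes
([infinite_dimensional_imaginary_root]). Hence a finite dimensional Nichols
algebra over a real class of non-involutions forces l = -1
([real_class_finite_dimensional]), and then g has even order.

To compare these derivations with quantum symmetrizers, the quantum symmetrizer
is computed on words in the letters of a diagonal subspace: a reduced word for s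
multiplies a word by the product of the braiding scalars over the inversions of
s, and splitting permutations according to the preimage of the first position
gives precisely the recursion of the derivations ([symmetrizer_coef_pairing]).
A finite dimensional quotient of the tensor algebra must kill all tensors of
large degree, so the pairing of long words would vanish.

In PGL(2, q), the matrices diag(-1, 1) and the antidiagonal (0, 1; 1, 0)
conjugate c2, c3 and c5 to their inverses, and c2, c3 and c5 are not involutions.
The order of c2 divides the odd number q, which is incompatible with l = -1.
Since c4 and c6 are involutions, l is 1 or -1, so l = -1; this is turned into a
list of characters by classifying the irreducible representations of a dihedral
group on which the central rotation r^m acts as -1
([dihedral_irr_character]). *)

(** * Braided derivations on words *)

Section SkewDerivations.

Variables (k : fieldType) (B : eqType) (q : B -> B -> k).
Implicit Types (b : B) (f : seq B -> k) (w v : seq B).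

(** The transpose of a braided derivation, on functionals: if d_b denotes the
derivation of the free algebra that strips the letter b from a word after moving
it to the front, each letter a passed on the way contributing the factor q a b,
then [skew b f] is f composed with d_b. Functionals take the place of
noncommutative polynomials throughout. *)
Fixpoint skew b f w : k :=
  if w is a :: w' then
    (a == b)%:R * f w' + q a b * skew b (fun u => f (a :: u)) w'
  else 0.

(** The pairing of the tensor algebra with itself whose radical is the ideal of
relations of the Nichols algebra of diagonal type q, on pairs of words of equal
length. *)
Definition pairing v : seq B -> k := foldr skew (fun w => (w == [::])%:R) v.

Lemma eq_skew b f g w : f =1 g -> skew b f w = skew b g w.
Proof.
by elim: w f g => //= a w IH f g fg; rewrite fg (IH _ (fun u => g (a :: u))).
Qed.

Lemma skewB b c f g w :
  skew b (fun u => f u - c * g u) w = skew b f w - c * skew b g w.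
Proof.
elim: w f g => [|a w IH] f g /=; first by ring.
by rewrite IH; ring.
Qed.

(** With trivial braiding the derivation is the ordinary one, d (x^n) = n
x^(n-1). *)
Lemma pairing_nseq b n : q b b = 1 ->
  pairing (nseq n b) (nseq n b) = n`!%:R.
Proof.
move=> qb.
have skewE f m : skew b f (nseq m.+1 b) = m.+1%:R * f (nseq m b).
  elim: m f => [|m IH] f; first by rewrite /= eqxx mulr0 addr0.
  rewrite -[LHS]/((b == b)%:R * f (nseq m.+1 b) +
    q b b * skew b (fun u => f (b :: u)) (nseq m.+1 b)) eqxx IH qb.
  by rewrite !mul1r -[m.+2%:R]natr1 mulrDl mul1r addrC.
by elim: n => [|n IH] //; rewrite [LHS]skewE factS natrM -IH.
Qed.

Variables (b1 b2 : B).

(** Left multiplication by the braided commutator y = b1 b2 - q12 b2 b1,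
transposed to functionals. *)
Definition bracket f w : k :=
  f [:: b1, b2 & w] - q b1 b2 * f [:: b2, b1 & w].

Fixpoint at_bracket_power n f : k :=
  if n is m.+1 then at_bracket_power m (bracket f) else f [::].

Lemma eq_at_bracket_power n f g :
  (forall w, size w = n.*2 -> all (pred2 b1 b2) w -> f w = g w) ->
  at_bracket_power n f = at_bracket_power n g.
Proof.
elim: n f g => [|n IH] f g fg /=; first exact: fg.
by apply: IH => w sw wb; rewrite /bracket !fg //= ?sw ?doubleS ?eqxx ?orbT.
Qed.

Lemma at_bracket_powerD n c d f g :
  at_bracket_power n (fun w => c * f w + d * g w) =
  c * at_bracket_power n f + d * at_bracket_power n g.
Proof.
elim: n f g => //= n IH f g; rewrite -IH; apply: eq_at_bracket_power => w _ _.
by rewrite /bracket; ring.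
Qed.

Hypotheses (neq12 : b1 != b2) (q121 : q b1 b1 * q b2 b1 = 1)
  (q122 : q b1 b2 * q b2 b2 = 1).

(** The Leibniz rule for the derivation by b1. Its derivative of y is (1 - q12
q21) b2, and moving b1 across y costs q11 q21 = 1. *)
Lemma bracket_skew1 f w : bracket (skew b1 f) w =
  (1 - q b1 b2 * q b2 b1) * f (b2 :: w) + skew b1 (bracket f) w.
Proof.
rewrite /bracket /= eqxx (eq_sym b2) (negPf neq12) !mulr0n !mulr1n.
rewrite (skewB b1 _ (fun u => f [:: b1, b2 & u]) (fun u => f [:: b2, b1 & u])).
set S1 := skew _ (fun u => f [:: b1, b2 & u]) w.
set S2 := skew _ (fun u => f [:: b2, b1 & u]) w.
apply/eqP; rewrite -subr_eq0; apply/eqP.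
transitivity ((q b1 b1 * q b2 b1 - 1) * (S1 - q b1 b2 * S2)); first by ring.
by rewrite q121 subrr mul0r.
Qed.

(** The derivation by b2 annihilates y, which is what the coefficient q12 in y
is chosen for, and b2 crosses y at the cost q12 q22 = 1. *)
Lemma bracket_skew2 f w : bracket (skew b2 f) w = skew b2 (bracket f) w.
Proof.
rewrite /bracket /= eqxx (negPf neq12) !mulr0n !mulr1n.
rewrite (skewB b2 _ (fun u => f [:: b1, b2 & u]) (fun u => f [:: b2, b1 & u])).
set S1 := skew _ (fun u => f [:: b1, b2 & u]) w.
set S2 := skew _ (fun u => f [:: b2, b1 & u]) w.
apply/eqP; rewrite -subr_eq0; apply/eqP.
transitivity ((q b1 b2 * q b2 b2 - 1) * (S1 - q b1 b2 * S2)); first by ring.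
by rewrite q122 subrr mul0r.
Qed.

Lemma at_bracket_power_skew2 n f : at_bracket_power n (skew b2 f) = 0.
Proof.
elim: n f => //= n IH f; rewrite -(IH (bracket f)).
by apply: eq_at_bracket_power => w _ _; apply: bracket_skew2.
Qed.

(** By the Leibniz rule each of the n + 1 factors y of a power is turned into (1
- q12 q21) b2 by the first derivation; the second one kills the other factors
and so only removes this b2. *)
Lemma at_bracket_power_skew12 n f :
  at_bracket_power n.+1 (skew b1 (skew b2 f)) =
  n.+1%:R * (1 - q b1 b2 * q b2 b1) * at_bracket_power n f.
Proof.
set c := 1 - _.
have step m g : at_bracket_power m.+1 (skew b1 (skew b2 g)) =
    c * at_bracket_power m g +
    at_bracket_power m (skew b1 (skew b2 (bracket g))).
  (* Stripping b2 from b2 y^m gives y^m, since the derivative of y^m is zero. *)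
  have -> : at_bracket_power m g =
      at_bracket_power m (fun w => skew b2 g (b2 :: w)).
    rewrite /= eqxx -[LHS]mul1r -[LHS]addr0.
    rewrite -(mulr0 (q b2 b2)).
    rewrite -(at_bracket_power_skew2 m (fun u => g (b2 :: u))).
    by rewrite -at_bracket_powerD; apply: eq_at_bracket_power.
  rewrite -[at_bracket_power m (skew _ _)]mul1r -at_bracket_powerD.
  rewrite -[LHS]/(at_bracket_power m (bracket (skew b1 (skew b2 g)))).
  apply: eq_at_bracket_power => w _ _; rewrite bracket_skew1.
  by rewrite (eq_skew b1 _ (bracket_skew2 g)) mul1r.
elim: n f => [|n IH] f; first by rewrite step /= addr0 mul1r.
by rewrite step IH -[n.+2%:R]natr1 /=; ring.
Qed.

Lemma at_bracket_power_pairing n :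
  at_bracket_power n (pairing (flatten (nseq n [:: b1; b2]))) =
  n`!%:R * (1 - q b1 b2 * q b2 b1) ^+ n.
Proof.
elim: n => [|n IH]; first by rewrite /= mulr1.
rewrite [LHS]at_bracket_power_skew12 IH factS natrM exprS; ring.
Qed.

End SkewDerivations.

(** * Quantum symmetrizers of diagonal braidings *)

Section DiagonalBraiding.

Variables (k : fieldType) (B : finType).
Variable c : {linear {ffun B * B -> k^o} -> {ffun B * B -> k^o}}.
Variables (A : {pred B}) (q : B -> B -> k).

Definition delta_tensor n (w : 'I_n -> B) : tensor_power k B n :=
  [ffun v : n.-tuple B => [forall i, tnth v i == w i]%:R].

(** The scalar picked up when the braid lifting s is applied to the word w: each
inversion of s is one crossing of two letters. *)
Definition inversion_weight n (w : 'I_n -> B) (s : 'S_n) : k :=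
  \prod_(p in inversions s) q (w p.1) (w p.2).

Lemma tperm_adjacent_lt n (i i' a b : 'I_n) : i' = i.+1 :> nat ->
  (a, b) != (i, i') -> (a, b) != (i', i) ->
  (tperm i i' a < tperm i i' b)%N = (a < b)%N.
Proof.
have E (x y : 'I_n) : (x == y) = (x == y :> nat) by [].
by rewrite -!pair_eqE /= !permE /= !E; do ![case: ifP]; lia.
Qed.

(** Composing s with the transposition at a descent removes exactly one
inversion and permutes the others. *)
Lemma inversion_weight_descent n (w : 'I_n -> B) s p : descent s p ->
  inversion_weight w s = q (w p.1) (w p.2) *
    inversion_weight (w \o tperm p.1 p.2) (tperm p.1 p.2 * s)%g.
Proof.
case: p => i i' /andP[/eqP /= ii' lt_s]; set t := tperm i i'.
have lt_i'i : (i' < i)%N = false by rewrite ii' ltnNge leqnSn.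
have p_inv : (i, i') \in inversions s by rewrite inE /= ii' ltnSn.
rewrite /inversion_weight (bigD1 (i, i')) //=; congr (_ * _).
pose f (p : 'I_n * 'I_n) := (t p.1, t p.2).
have fK : involutive f by case=> a b; rewrite /f /= !tpermK.
rewrite (reindex_inj (inv_inj fK)); apply: eq_bigl => -[a b].
rewrite !inE /= !permM /f /=.
have [[-> ->]|n1] := eqVneq (a, b) (i, i').
  by rewrite /t tpermL tpermR lt_i'i (leq_gtF (ltnW lt_s)) !andbF.
have [[-> ->]|n2] := eqVneq (a, b) (i', i).
  by rewrite /t tpermL tpermR eqxx andbF lt_i'i.
rewrite (tperm_adjacent_lt ii') // -[LHS]andbA; congr (_ && _).
rewrite [X in _ && ~~ X](_ : _ = false) ?andbT //.
apply: contraNF n2 => /eqP[E1 E2].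
by rewrite -(tpermK i i' a) -(tpermK i i' b) -/t E1 E2 /t tpermL tpermR.
Qed.

Lemma eq_delta_tensor n (w w' : 'I_n -> B) : w =1 w' ->
  delta_tensor w = delta_tensor w'.
Proof.
move=> ww'; apply/ffunP=> v; rewrite !ffunE.
by under eq_forallb do rewrite ww'.
Qed.

Lemma braid_wordZ n r a (t : tensor_power k B n) :
  braid_word c r (a *: t) = a *: braid_word c r t.
Proof.
have lin := braid_word_is_linear c r.
have r0 : braid_word c r (0 : tensor_power k B n) = 0.
  by have := lin (-1) 0 0; rewrite scaler0 addr0 scaleN1r addNr.
by rewrite -[a *: t]addr0 lin r0 addr0.
Qed.

Hypothesis braidA : {in A &, forall a b,
  c [ffun ab => (ab == (a, b))%:R] = q a b *: [ffun ab => (ab == (b, a))%:R]}.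

Lemma braid_at_delta n (w : 'I_n -> B) p :
  (forall i, w i \in A) -> p.1 != p.2 ->
  braid_at c p (delta_tensor w) =
  q (w p.1) (w p.2) *: delta_tensor (w \o tperm p.1 p.2).
Proof.
case: p => i i' /= wA nii'; apply/ffunP=> v; rewrite !ffunE /=.
pose off := [forall j, (j != i) ==> (j != i') ==> (tnth v j == w j)].
have -> : [ffun ab => delta_tensor w (subst2 v (i, i') ab)] =
    off%:R *: [ffun ab => (ab == (w i, w i'))%:R] :> {ffun B * B -> k^o}.
  apply/ffunP=> -[a b]; rewrite !ffunE /= /GRing.scale /= -natrM mulnb.
  congr (nat_of_bool _)%:R; rewrite -pair_eqE /=.
  apply/forallP/andP => [H|[/forallP H /andP[/eqP Ea /eqP Eb]] j].
    split; last first.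
      by have:= H i; have:= H i'; rewrite !tnth_mktuple /= !eqxx
           (eq_sym i') (negPf nii') => -> ->.
    apply/forallP=> j; apply/implyP=> n1; apply/implyP=> n2.
    by have:= H j; rewrite !tnth_mktuple /= (negPf n1) (negPf n2).
  rewrite tnth_mktuple /=; case: (eqVneq j i) => [->|n1]; first by rewrite Ea.
  case: (eqVneq j i') => [->|n2]; first by rewrite Eb.
  by have := H j; rewrite n1 n2.
rewrite linearZ /= braidA // !ffunE /= /GRing.scale /= mulrCA; congr (_ * _).
rewrite -natrM mulnb; congr (nat_of_bool _)%:R; rewrite -pair_eqE /=.
apply/andP/forallP => [[/forallP H /andP[/eqP Ea /eqP Eb]] j|H].
  rewrite permE /=; case: (eqVneq j i) => [->|n1]; first by rewrite Ea.
  case: (eqVneq j i') => [->|n2]; first by rewrite Eb.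
  by have := H j; rewrite n1 n2.
split; last first.
  by have:= H i; have:= H i'; rewrite tpermL tpermR => -> ->.
apply/forallP=> j; apply/implyP=> n1; apply/implyP=> n2.
by have:= H j; rewrite tpermD // eq_sym.
Qed.

(** Peeling the last letter off the reduced word, which is a descent of s,
reduces the claim to [inversion_weight_descent]. *)
Lemma braid_word_delta n (w : 'I_n -> B) s : (forall i, w i \in A) ->
  braid_word c (reduced_word s) (delta_tensor w) =
  inversion_weight w s *: delta_tensor (w \o (s^-1)%g).
Proof.
rewrite /reduced_word; move Em: #|inversions s| => m.
elim: m s Em w => [|m IH] s Em w wA /=; case E: (last_descent s) => [p|].
- by have := ninv_descent (last_descentS E); rewrite Em.
- rewrite (last_descentN E) /inversion_weight inversions1 big_set0 scale1r.
  by apply: eq_delta_tensor => i /=; rewrite invg1 perm1.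
- have dp := last_descentS E; have /andP[/eqP ap _] := dp.
  have /esym/eqP := ninv_descent dp; rewrite Em eqSS => /eqP Em'.
  rewrite /braid_word foldr_rcons braid_at_delta //; last first.
    by rewrite -(inj_eq val_inj) [val p.2]ap ltn_eqF.
  rewrite -/(braid_word _ _ _) braid_wordZ IH //; last by move=> i; apply: wA.
  rewrite [LHS]scalerA -inversion_weight_descent //; congr (_ *: _).
  by apply: eq_delta_tensor => i /=; rewrite invMg permM tpermV tpermK.
- by move: Em; rewrite (last_descentN E) inversions1 cards0.
Qed.

Definition symmetrizer_coef n (w v : 'I_n -> B) : k :=
  \sum_(s : 'S_n) inversion_weight w s * [forall i, v (s i) == w i]%:R.

Lemma quantum_symmetrizer_delta n (w : 'I_n -> B) (v : n.-tuple B) :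
  (forall i, w i \in A) ->
  quantum_symmetrizer c (delta_tensor w) v = symmetrizer_coef w (tnth v).
Proof.
move=> wA; rewrite sum_ffunE; apply: eq_bigr => s _.
rewrite braid_word_delta // !ffunE /=; congr (_ * (nat_of_bool _)%:R).
by apply/forallP/forallP => H i; have := H ((s^-1)%g i); have := H (s i);
  rewrite /= ?permK ?permKV.
Qed.

End DiagonalBraiding.

Section Recursion.

Variables (k : fieldType) (B : finType) (q : B -> B -> k).

(** Permutations are classified by the preimage p of the first position. *)
Lemma sum_lift_perm n (F : 'S_n.+1 -> k) :
  \sum_s F s = \sum_p \sum_s F (lift_perm p ord0 s).
Proof.
rewrite pair_bigA /=.
pose h (x : 'I_n.+1 * 'S_n) := lift_perm x.1 ord0 x.2.
apply: (reindex h); apply: onW_bij.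
apply: inj_card_bij; last by rewrite card_prod !card_ord !card_Sn factS.
case=> p s [p' s'] E.
have Ep : p = p'.
  apply: (@perm_inj _ (h (p', s'))).
  by rewrite -[in LHS]E /h !lift_perm_id.
rewrite -{p'}Ep in E *; congr (_, _); apply/permP=> i.
by have /permP/(_ (lift p i)) := E; rewrite /h !lift_perm_lift => /lift_inj.
Qed.

(** The letter in position p is moved to the front and crosses precisely the
letters before it; the remaining inversions are those of s. *)
Lemma inversion_weight_lift_perm n (w : 'I_n.+1 -> B) p (s : 'S_n) :
  inversion_weight q w (lift_perm p ord0 s) =
  (\prod_(a < n.+1 | (a < p)%N) q (w a) (w p)) *
    inversion_weight q (w \o lift p) s.
Proof.
have weightE m (u : 'I_m -> B) t : inversion_weight q u t =
    \prod_(a < m) \prod_(b < m)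
      if (a < b)%N && (t b < t a)%N then q (u a) (u b) else 1.
  rewrite pair_bigA -big_mkcond; apply: eq_bigl => -[a b] /=.
  by rewrite inE.
rewrite !weightE (bigD1_ord p) //= big1 ?mul1r => [|b _]; last first.
  by rewrite lift_perm_id ltn0 andbF.
rewrite [X in _ = X * _]big_mkcond (bigD1_ord p) //= ltnn mul1r -big_split /=.
apply: eq_bigr => a _; rewrite (bigD1_ord p) //= lift_perm_id lift_perm_lift.
rewrite lift0 ltn0Sn andbT; congr (_ * _); apply: eq_bigr => b _.
by rewrite !lift_perm_lift !ltnNge !leq_bump2 negbK.
Qed.

Lemma symmetrizer_coefS n (w v : 'I_n.+1 -> B) :
  symmetrizer_coef q w v = \sum_p (w p == v ord0)%:R *
    (\prod_(a < n.+1 | (a < p)%N) q (w a) (w p)) *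
    symmetrizer_coef q (w \o lift p) (v \o lift ord0).
Proof.
rewrite /symmetrizer_coef sum_lift_perm; apply: eq_bigr => p _.
rewrite mulr_sumr; apply: eq_bigr => s _.
rewrite inversion_weight_lift_perm.
have -> : [forall i, v (lift_perm p ord0 s i) == w i] =
    (w p == v ord0) && [forall i, v (lift ord0 (s i)) == w (lift p i)].
  apply/forallP/andP => [H|[/eqP wp /forallP H] i].
    split; first by have := H p; rewrite lift_perm_id eq_sym.
    by apply/forallP=> i; have := H (lift p i); rewrite lift_perm_lift.
  by case: (unliftP p i) => [j|] ->; rewrite ?lift_perm_lift ?lift_perm_id ?wp.
by rewrite -mulnb natrM /=; ring.
Qed.

Lemma skew_enum b f n (w : 'I_n.+1 -> B) :
  skew q b f [seq w i | i <- enum 'I_n.+1] =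
  \sum_p (w p == b)%:R * (\prod_(a < n.+1 | (a < p)%N) q (w a) (w p)) *
    f [seq w (lift p i) | i <- enum 'I_n].
Proof.
elim: n f w => [|n IH] f w; rewrite enum_ordSl /=.
  by rewrite enum_ord0 big_ord1 /= big_pred0 // mulr0 addr0 mulr1.
rewrite -map_comp (IH (fun u => f (w ord0 :: u)) (w \o lift ord0)).
rewrite [RHS]big_ord_recl; congr (_ + _).
  by rewrite [\prod_(a < _ | _) _]big_pred0 // mulr1 -map_comp.
rewrite mulr_sumr; apply: eq_bigr => p _ /=.
rewrite [in RHS]big_mkcond [in RHS]big_ord_recl /= [in RHS]enum_ordSl /=.
rewrite -map_comp.
rewrite -big_mkcond (_ : lift (lift ord0 p) ord0 = ord0); last exact: val_inj.
have -> : [seq w (lift ord0 (lift p i)) | i <- enum 'I_n] =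
    [seq w (lift (lift ord0 p) (lift ord0 i)) | i <- enum 'I_n].
  apply: eq_map => i; congr w; apply: val_inj.
  by rewrite /= /bump !leq0n !add1n ltnS addnS.
case: eqVneq => [->|_]; last by rewrite !mul0r mulr0.
by rewrite !mul1r mulrA.
Qed.

(** Both sides satisfy the same recursion on the first letter of v: by
[skew_enum] the braided derivation is the sum over the positions from which that
letter can come. *)
Lemma symmetrizer_coef_pairing n (w v : 'I_n -> B) :
  symmetrizer_coef q w v =
  pairing q [seq v i | i <- enum 'I_n] [seq w i | i <- enum 'I_n].
Proof.
elim: n w v => [|n IH] w v.
  rewrite enum_ord0 /= /symmetrizer_coef (bigD1 1%g) //= big1 => [|s /eqP[]].
    rewrite addr0 /inversion_weight inversions1 big_set0 mul1r.
    by rewrite (_ : [forall i, _]) //; apply/forallP; case.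
  by apply/permP; case.
rewrite symmetrizer_coefS [X in pairing q (map v X)]enum_ordSl /= -map_comp.
rewrite skew_enum.
by apply: eq_bigr => p _; rewrite IH.
Qed.

End Recursion.

(** * Infinite dimensional Nichols algebras *)

Section FiniteDimension.

Variables (k : fieldType) (B : finType).
Variable c : {linear {ffun B * B -> k^o} -> {ffun B * B -> k^o}}.

Lemma component_surj n (t : tensor_power k B n) :
  exists T : tensor_algebra k B, component n T = t.
Proof.
exists (\sum_(w : n.-tuple B) t w *: << FMonom w >>).
apply/ffunP=> w; rewrite ffunE raddf_sum /= (bigD1 w) //= big1 => [|v nvw].
  by rewrite addr0 mcoeffZ mcoeffU eqxx mulr1.
rewrite mcoeffZ mcoeffU (_ : _ == _ = false) ?mulr0 //.
by apply: contraNF nvw => /eqP[E]; apply/eqP/val_inj.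
Qed.

(** A finite family of classes has representatives of bounded degree. Beyond
that degree the homogeneous components of their combinations vanish, so every
tensor is congruent to 0 modulo the ideal, which is graded. *)
Lemma finite_dimensional_symmetrizer0 :
  finite_dimensional (nichols_algebra c) ->
  exists N, forall n (t : tensor_power k B n), (N <= n)%N ->
    quantum_symmetrizer c t = 0.
Proof.
case=> s span.
pose lift_s := map (fun x : nichols_algebra c =>
  generic_quotient.repr (x : {ideal_quot (nichols_ideal c)})) s.
pose N := (\max_(T <- lift_s) \max_(m <- msupp T) size m).+1.
have comp0 n T : T \in lift_s -> (N <= n)%N ->
    component n T = 0 :> tensor_power k B n.
  move=> Ts Nn; apply/ffunP=> w; rewrite !ffunE; apply/eqP.
  rewrite mcoeff_eq0; apply/negP => wT.
  move: Nn; rewrite /N ltnNge => /negP; apply.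
  apply: leq_trans (leq_bigmax_seq _ Ts isT).
  have <- : size (FMonom w) = n by apply: size_tuple.
  exact: (leq_bigmax_seq _ wT isT).
exists N => n t Nn.
have [T <-] := component_surj t.
have [a Ea] := span (nichols_class c T).
pose U := \sum_i a i *: lift_s`_i.
have : T - U \in nichols_ideal c.
  rewrite -nichols_class_eq Ea /U linear_sum /=; apply/eqP.
  apply: eq_bigr => i _; rewrite linearZ /=; congr (_ *: _).
  by rewrite (nth_map 0) // /nichols_class reprK.
move/nichols_idealP/(_ n); rewrite linearB linearB /= => /eqP.
rewrite subr_eq0 => /eqP ->.
rewrite /U linear_sum /= big1 ?linear0 // => i _.
rewrite linearZ /= comp0 ?scaler0 //.
by rewrite mem_nth ?size_map.
Qed.

Variables (A : {pred B}) (q : B -> B -> k).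
Hypothesis braidA : {in A &, forall a b,
  c [ffun ab => (ab == (a, b))%:R] = q a b *: [ffun ab => (ab == (b, a))%:R]}.
Hypothesis char_k : [pchar k] =i pred0.

Lemma finite_dimensional_pairing0 :
  finite_dimensional (nichols_algebra c) ->
  exists N, forall v w, size v = size w -> (N <= size w)%N -> all (mem A) w ->
    pairing q v w = 0.
Proof.
case/finite_dimensional_symmetrizer0 => N sym0; exists N => v w Evw Nw wA.
move: Evw; move/eqP=> vP; pose tv := Tuple vP; pose tw := in_tuple w.
have := symmetrizer_coef_pairing q (tnth tw) (tnth tv).
rewrite !map_tnth_enum => <-; rewrite -(quantum_symmetrizer_delta braidA).
  by rewrite sym0 // ffunE.
by move=> i; apply: (allP wA); apply: mem_tnth.
Qed.

Lemma fact_neq0 n : n`!%:R != 0 :> k.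
Proof. by rewrite ((pcharf0P k).1 char_k) -lt0n fact_gt0. Qed.

Lemma infinite_dimensional_trivial_braiding a :
  a \in A -> q a a = 1 -> ~ finite_dimensional (nichols_algebra c).
Proof.
move=> aA qa /finite_dimensional_pairing0[N H].
have N_le : (N <= size (nseq N a))%N by rewrite size_nseq.
have A_nseq : all (mem A) (nseq N a) by apply/allP=> x /nseqP[->].
have /eqP := H _ _ erefl N_le A_nseq.
by rewrite pairing_nseq // (negPf (fact_neq0 N)).
Qed.

(** The first two hypotheses say that moving a or b to the front of the braided
commutator y of a and b costs the factor 1, the third one that y is not zero.
Then all powers of y survive: [at_bracket_power_pairing] pairs y^N with the word
(a b)^N. For q a a = q b b = l and q a b = q b a = l^-1 the hypotheses hold as
soon as l^2 <> 1. *)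
Lemma infinite_dimensional_imaginary_root a b :
    a \in A -> b \in A -> a != b ->
    q a a * q b a = 1 -> q a b * q b b = 1 -> q a b * q b a != 1 ->
  ~ finite_dimensional (nichols_algebra c).
Proof.
move=> aA bA ab qa qb qab /finite_dimensional_pairing0[N H].
have := at_bracket_power_pairing ab qa qb N => /eqP; apply/negP.
have v_size : size (flatten (nseq N [:: a; b])) = N.*2.
  by rewrite size_flatten /shape map_nseq sumn_nseq mulnC muln2.
rewrite (@eq_at_bracket_power _ _ _ _ _ _ _ (fun=> 0)); last first.
  move=> w sw /allP wab; apply: H; first by rewrite v_size sw.
    by rewrite sw -addnn leq_addr.
  by apply/allP=> x /wab /pred2P[]->.
rewrite (_ : at_bracket_power _ _ _ _ _ = 0).
  by rewrite eq_sym mulf_neq0 ?fact_neq0 // expf_neq0 // subr_eq0 eq_sym.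
elim: N {H v_size} => //= n IH; rewrite -[RHS]IH.
by apply: eq_at_bracket_power => w _ _; rewrite /bracket mulr0 subr0.
Qed.

End FiniteDimension.

(** * Finite dimensional Nichols algebras over a real class *)

Section RealClasses.

Variables (k : closedFieldType) (gT : finGroupType) (G : {group gT}) (g : gT).
Hypotheses (char_k : [pchar k] =i pred0) (Gg : g \in G).
Variables (d : nat) (rho : mx_representation k 'C_G[g]%g d).
Hypothesis irr_rho : mx_irreducible rho.

Lemma cent1_self : g \in 'C_G[g]%g.
Proof. by rewrite inE Gg cent1id. Qed.

(** Schur's lemma, g being central in its centralizer. *)
Lemma repr_center_scalar : exists2 a, a != 0 & rho g = a%:M.
Proof.
have [] : is_scalar_mx (rho g) /\ rho g \in unitmx.
  split; last by rewrite repr_mx_unit ?cent1_self.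
  have abs_irr := group_closure_closed_field irr_rho.
  apply: (mx_abs_irr_cent_scalar abs_irr); apply/centgmxP=> h Hh.
  rewrite -!repr_mxM ?cent1_self //; congr (rho _).
  by case/setIP: Hh => _ /cent1P.
case/is_scalar_mxP=> a Ea; have [d_gt0 _] := (mx_irrP rho).1 irr_rho.
rewrite Ea unitmxE det_scalar unitfE expf_eq0 d_gt0 /= => a0.
by exists a.
Qed.

(** The coaction of a basis vector b is y g y^-1 with y = yd_rep b. Moving this
element past another coset representative leaves an element h of the
centralizer; when rho h is a scalar the two basis vectors braid diagonally. *)
Lemma yd_braiding_basis (a b : yd_basis G g d) h l :
    h \in 'C_G[g]%g -> rho h = l%:M ->
    (yd_rep a * g * (yd_rep a)^-1 * yd_rep b = yd_rep b * h)%g ->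
  yd_braiding rho [ffun ab => (ab == (a, b))%:R] =
  l *: [ffun ab => (ab == (b, a))%:R].
Proof.
move=> Ch rho_h Eh.
have deltaE (u v : yd_basis G g d) : [ffun ab => (ab == (u, v))%:R] =
    tensor2 (yd_tensor rho (yd_rep u) (yd_vec k u))
            (yd_tensor rho (yd_rep v) (yd_vec k v)).
  apply/ffunP=> -[x y]; rewrite !yd_tensor_basis !ffunE /= -natrM mulnb.
  by rewrite -pair_eqE.
rewrite !deltaE yd_braidingE ?yd_rep_in // Eh yd_tensor_balanced // rho_h.
rewrite mul_scalar_mx linearZ /=; apply/ffunP=> x; rewrite !ffunE /=.
by rewrite /GRing.scale /= mulrA.
Qed.

Lemma lcoset_in x : x \in G -> (x *: 'C_G[g])%g \in lcosets 'C_G[g] G.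
Proof. by move=> Gx; apply/lcosetsP; exists x. Qed.

Definition coset_letter (x : gT) (Gx : x \in G) (i : 'I_d) : yd_basis G g d :=
  (exist _ (x *: 'C_G[g])%g (lcoset_in Gx), i).

Lemma coset_letterP x Gx i : exists2 h, h \in 'C_G[g]%g &
  (yd_rep (@coset_letter x Gx i) = x * h)%g.
Proof.
have := yd_rep_mem (@coset_letter x Gx i); rewrite /= => /lcosetP[h Hh E].
by exists h.
Qed.

Lemma irr_repr_gt0 : (0 < d)%N.
Proof. by have [] := (mx_irrP rho).1 irr_rho. Qed.

Lemma finite_dimensional_repr_neq1 :
  finite_dimensional (nichols rho) -> rho g <> 1%:M.
Proof.
move=> fin_dim rho1; pose a := coset_letter (group1 G) (Ordinal irr_repr_gt0).
apply: (@infinite_dimensional_trivial_braiding _ _ (yd_braiding rho) (pred1 a)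
  (fun _ _ => 1) _ char_k a _ _ fin_dim); rewrite ?inE //.
move=> _ _ /eqP-> /eqP->; apply: yd_braiding_basis cent1_self rho1 _.
by rewrite mulgKV.
Qed.

(** The letters a and b span a diagonal braided subspace of affine type A_1^(1):
each of them acts on itself by l, and on the other one by l^-1, because g and
g^-1 are conjugated into each other by the coset representatives. *)
Lemma inverse_coaction_scalar (a b : yd_basis G g d) l :
    (yd_rep a * g * (yd_rep a)^-1 = g)%g ->
    (yd_rep b * g * (yd_rep b)^-1 = g^-1)%g ->
    a != b -> rho g = l%:M -> l != 0 -> l ^+ 2 != 1 ->
  ~ finite_dimensional (nichols rho).
Proof.
move=> coact_a coact_b ab rho_g l0 l2.
have rho_gV : rho g^-1%g = l^-1%:M.
  by rewrite repr_mxV ?cent1_self // rho_g invmx_scalar.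
have C_gV : (g^-1 \in 'C_G[g])%g by rewrite groupV cent1_self.
pose q (u v : yd_basis G g d) : k := if u == v then l else l^-1.
have q_eq u : q u u = l by rewrite /q eqxx.
have q_ab : q a b = l^-1 by rewrite /q (negbTE ab).
have q_ba : q b a = l^-1 by rewrite /q eq_sym (negbTE ab).
apply: (@infinite_dimensional_imaginary_root _ _ (yd_braiding rho)
  (pred2 a b) q _ char_k a b).
- move=> u v; rewrite !inE => uP vP; rewrite /q.
  case: (eqVneq u v) => [<-|nuv].
    by apply: yd_braiding_basis cent1_self rho_g _; rewrite mulgKV.
  apply: yd_braiding_basis C_gV rho_gV _.
  case/pred2P: uP nuv => ->; case/pred2P: vP => ->; rewrite ?eqxx // => _.
    rewrite coact_a; apply: (mulIg (yd_rep b)^-1)%g; rewrite mulgK.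
    by apply: invg_inj; rewrite !invMg !invgK mulgA coact_b.
  rewrite coact_b; apply/esym/commuteV.
  by apply: (mulIg (yd_rep a)^-1)%g; rewrite coact_a mulgK.
- by rewrite inE eqxx.
- by rewrite inE eqxx orbT.
- exact: ab.
- by rewrite q_eq q_ba mulfV.
- by rewrite q_eq q_ab mulVf.
by rewrite q_ab q_ba -expr2 exprVn invr_eq1.
Qed.

(** The basis vectors over the cosets of 1 and x have coactions g and g^-1, and
these cosets are distinct because g is not an involution. *)
Lemma real_class_finite_dimensional x : x \in G ->
    (x * g * x^-1 = g^-1)%g -> (g^-1 != g)%g ->
  finite_dimensional (nichols rho) -> rho g = (-1)%:M.
Proof.
move=> Gx xg g2 fin_dim; have [l l0 rho_g] := repr_center_scalar.
have [/eqP|l2] := eqVneq (l ^+ 2) 1.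
  rewrite sqrf_eq1 => /pred2P[] El; last by rewrite rho_g El.
  by case: (finite_dimensional_repr_neq1 fin_dim); rewrite rho_g El.
pose i0 := Ordinal irr_repr_gt0.
have [h /setIP[_ /cent1P comm_h] rep_a] := coset_letterP (group1 G) i0.
have [h' /setIP[_ /cent1P comm_h'] rep_b] := coset_letterP Gx i0.
case: (@inverse_coaction_scalar (coset_letter (group1 G) i0)
  (coset_letter Gx i0) l _ _ _ rho_g l0 l2 fin_dim).
- by rewrite rep_a mul1g comm_h mulgK.
- by rewrite rep_b -xg invMg !mulgA -(mulgA x) comm_h' !mulgA mulgK.
apply: contraNneq g2 => /(congr1 (fun y => val y.1)) /= E.
have : x \in (1%g *: 'C_G[g])%g by rewrite E lcoset_refl.
rewrite mem_lcoset invg1 mul1g; case/setIP=> _ /cent1P.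
by rewrite -xg /commute => ->; rewrite mulgK.
Qed.

Lemma involution_finite_dimensional : (g ^+ 2 = 1)%g ->
  finite_dimensional (nichols rho) -> rho g = (-1)%:M.
Proof.
move=> g2 fin_dim; have [l l0 rho_g] := repr_center_scalar.
pose i0 := Ordinal irr_repr_gt0.
have /matrixP/(_ i0 i0) : rho g *m rho g = 1%:M.
  by rewrite -repr_mxM ?cent1_self // -[(g * g)%g]/(g ^+ 2)%g g2 repr_mx1.
rewrite rho_g -scalar_mxM !mxE eqxx !mulr1n -expr2 => /eqP.
rewrite sqrf_eq1 => /pred2P[] El; last by rewrite El.
by case: (finite_dimensional_repr_neq1 fin_dim); rewrite rho_g El.
Qed.

Lemma repr_opp1_even n : rho g = (-1)%:M -> (g ^+ n = 1)%g -> ~~ odd n.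
Proof.
move=> rho_g gn; apply/negP=> n_odd; pose i0 := Ordinal irr_repr_gt0.
have rhoX m : rho (g ^+ m)%g = ((-1) ^+ m)%:M.
  elim: m => [|m IH]; first by rewrite expg0 repr_mx1.
  rewrite expgS repr_mxM ?groupX ?cent1_self // IH rho_g exprS.
  by rewrite -scalar_mxM.
have /matrixP/(_ i0 i0) := rhoX n; rewrite gn repr_mx1 -signr_odd n_odd expr1.
rewrite !mxE eqxx !mulr1n => /eqP; rewrite -addr_eq0 -[_ + _]/(2%:R).
by rewrite ((pcharf0P k).1 char_k).
Qed.

End RealClasses.

(** * Irreducible representations of dihedral groups *)

Lemma mxtrace_conj (k : fieldType) d (P A M : 'M[k]_d) :
  P \in unitmx -> P *m A = M *m P -> \tr A = \tr M.
Proof.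
by move=> uP E; rewrite -[M](mulmxK uP) -E -mulmxA mxtrace_mulC mulmxKV.
Qed.

Section Dihedral.

Variables (k : closedFieldType) (gT : finGroupType) (D : {group gT}).
Variables (m : nat) (r s : gT) (z : k).
Hypotheses (char_k : [pchar k] =i pred0) (m_gt0 : (0 < m)%N).
Hypothesis gen_rs : dihedral_generators D m.*2 r s.
Hypothesis prim_z : m.*2.-primitive_root z.

Let gen_r : r \in D.
Proof. by case: gen_rs => _ _ _ <- _; rewrite mem_gen // !inE eqxx. Qed.

Let gen_s : s \in D.
Proof. by case: gen_rs => _ _ _ <- _; rewrite mem_gen // !inE eqxx orbT. Qed.

Let N1_neq1 : (-1 != 1 :> k).
Proof.
by rewrite eq_sym -addr_eq0 -[_ + _]/(2%:R) ((pcharf0P k).1 char_k).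
Qed.

Lemma primitive_root_half : z ^+ m = -1.
Proof.
apply/eqP; have := prim_expr_order prim_z.
rewrite -muln2 exprM => /eqP; rewrite sqrf_eq1 => /orP[|//].
rewrite -(prim_order_dvd prim_z) => /dvdn_leq; rewrite m_gt0 => /(_ isT); lia.
Qed.

(** Write x = z ^ h with h < 2m. Exchanging h and 2m - h exchanges x and its
inverse, so h may be taken below m, the value h = m being excluded by x <> -1.
*)
Lemma primitive_root_odd_half (x : k) : x ^+ m = -1 -> x != -1 ->
  exists h, [/\ (0 < h)%N, (h.*2 < m.*2)%N, odd h &
    forall j, z ^+ (h * j) + z ^- (h * j) = x ^+ j + x ^- j].
Proof.
move=> xm xN1.
have odd_exp h : z ^+ h = x -> odd h.
  move=> zh; have := N1_neq1.
  rewrite -{1}xm -zh -exprM mulnC exprM primitive_root_half -signr_odd.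
  by case: (odd h); rewrite // expr0 eqxx.
have /(prim_rootP prim_z)[[h lt_h] /= Ex] : x ^+ m.*2 = 1.
  by rewrite -muln2 exprM xm sqrrN expr1n.
have h_odd : odd h by apply: odd_exp.
have hm : h != m.
  by apply: contraNneq xN1 => hm; rewrite Ex hm primitive_root_half.
have [lt_hm|le_mh] := ltnP h m.
  exists h; split=> //; first by case: (h) h_odd.
    by rewrite ltn_double.
  by move=> j; rewrite Ex -!exprM.
have h_gt0 : (0 < h)%N by case: (h) h_odd.
exists (m.*2 - h)%N; split; first by rewrite subn_gt0.
- move: le_mh hm lt_h; rewrite leq_eqVlt eq_sym => /predU1P[->|].
    by rewrite eqxx.
  lia.
- by rewrite oddB ?(ltnW lt_h) // odd_double.
have zh : z ^+ (m.*2 - h) = x^-1.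
  have zz : z ^+ (m.*2 - h) * x = 1.
    by rewrite Ex -exprD subnK ?(ltnW lt_h) // prim_expr_order.
  have x0 : x != 0.
    by apply: contra_eq_neq zz => ->; rewrite mulr0 eq_sym oner_eq0.
  by rewrite -[RHS]mul1r -zz mulfK.
by move=> j; rewrite exprM zh exprVn invrK addrC.
Qed.

Let relation_sr : (s * r = r^-1 * s)%g.
Proof.
case: gen_rs => _ s2 srs _ _.
by rewrite -srs -mulgA -[(s * s)%g]/(s ^+ 2)%g s2 mulg1.
Qed.

Lemma dihedral_character_dim1 (rho : mx_representation k D 1) :
  rho (r ^+ m)%g = (-1)%:M ->
  has_dihedral_character rho r s (@dihedral_chi3 k) \/
  has_dihedral_character rho r s (@dihedral_chi4 k).
Proof.
move=> rho_rm.
pose x := rho r 0 0; pose y := rho s 0 0.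
have rho_r : rho r = x%:M by rewrite [LHS]mx11_scalar.
have rho_s : rho s = y%:M by rewrite [LHS]mx11_scalar.
have rhoX (t : k) g j : g \in D -> rho g = t%:M -> rho (g ^+ j)%g = (t ^+ j)%:M.
  move=> Dg Et; elim: j => [|j IH]; first by rewrite expg0 repr_mx1.
  by rewrite expgS repr_mxM ?groupX // IH Et exprS scalar_mxM.
have scal_inj (a b : k) : a%:M = b%:M :> 'M_1 -> a = b.
  by move/matrixP/(_ 0 0); rewrite !mxE eqxx !mulr1n.
have y2 : y ^+ 2 = 1.
  apply: scal_inj; rewrite -(rhoX _ _ _ gen_s rho_s).
  by case: gen_rs => _ -> _ _ _; rewrite repr_mx1.
have x2 : x ^+ 2 = 1.
  apply: scal_inj; rewrite expr2 scalar_mxM -rho_r.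
  have := congr1 rho relation_sr; rewrite !repr_mxM ?groupV // rho_s.
  rewrite scalar_mxC => /(congr1 (mulmx y%:M)); rewrite !mulmxA.
  rewrite -scalar_mxM -expr2 y2 !mul1mx => {1}->.
  by rewrite -repr_mxM ?groupV // mulVg repr_mx1.
have xm : x ^+ m = -1 by apply: scal_inj; rewrite -(rhoX _ _ _ gen_r rho_r).
have xN1 : x = -1.
  move/eqP: x2; rewrite sqrf_eq1 => /pred2P[] // x1.
  by have := N1_neq1; rewrite -xm x1 expr1n eqxx.
have trE e j : \tr (rho (s ^+ e * r ^+ j)%g) = y ^+ e * (-1) ^+ j.
  rewrite repr_mxM ?groupX // (rhoX _ _ _ gen_s rho_s) (rhoX _ _ _ gen_r rho_r).
  by rewrite -scalar_mxM mxtrace_scalar mulr1n xN1.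
move/eqP: y2; rewrite sqrf_eq1 => /pred2P[] Ey; [left|right] => e j.
  by rewrite trE Ey expr1n mul1r.
by rewrite trE Ey -exprD addnC.
Qed.

Lemma dihedral_mxmodule d (rho : mx_representation k D d) p (U : 'M_(p, d)) :
  (U *m rho r <= U)%MS -> (U *m rho s <= U)%MS -> mxmodule rho U.
Proof.
move=> Ur Us; rewrite /mxmodule; case: gen_rs => _ _ _ <- _.
rewrite gen_subG; apply/subsetP=> x /set2P[] ->.
  by rewrite inE Ur gen_r.
by rewrite inE Us gen_s.
Qed.

Lemma eigenvector_repr_expg d (rho : mx_representation k D d)
    (w : 'rV_d) (a : k) j :
  w *m rho r = a *: w -> w *m rho (r ^+ j)%g = a ^+ j *: w.
Proof.
move=> wr; elim: j => [|j IH]; first by rewrite expg0 repr_mx1 mulmx1 scale1r.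
by rewrite expgSr repr_mxM ?groupX // mulmxA IH -scalemxAl wr scalerA exprSr.
Qed.

Lemma dihedral_eigenvector d (rho : mx_representation k D d) :
  mx_irreducible rho -> rho (r ^+ m)%g = (-1)%:M ->
  exists (u : 'rV[k]_d) (l : k), [/\ u != 0, u *m rho r = l *: u & l ^+ m = -1].
Proof.
move=> irr_rho rho_rm; have [d_gt0 _] := (mx_irrP rho).1 irr_rho.
have [l] : exists l, root (char_poly (rho r)) l.
  by apply/closed_rootP; rewrite size_char_poly eqSS -lt0n.
rewrite -eigenvalue_root_char => /eigenvalueP[u ur u0]; exists u, l; split=> //.
have := eigenvector_repr_expg m ur.
rewrite rho_rm -scalemx1 -scalemxAr mulmx1 => /eqP.
by rewrite -subr_eq0 -scalerBl scaler_eq0 (negPf u0) orbF subr_eq0 => /eqP.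
Qed.

(** An eigenvector u of r and its image v under s span a submodule, hence
everything, so d is 1 or 2. In dimension 2 the basis (u, v) makes r diagonal
with eigenvalues l and l^-1 and makes s r^j antidiagonal, which gives the
traces. *)
Lemma dihedral_irr_character d (rho : mx_representation k D d) :
  mx_irreducible rho -> rho (r ^+ m)%g = (-1)%:M ->
  [\/ has_dihedral_character rho r s (@dihedral_chi3 k),
      has_dihedral_character rho r s (@dihedral_chi4 k)
    | exists h : nat, [/\ (0 < h)%N, (h.*2 < m.*2)%N, odd h
        & has_dihedral_character rho r s (dihedral_mu z h)]].
Proof.
move=> irr_rho rho_rm; have [d_gt0 irrP] := (mx_irrP rho).1 irr_rho.
have [u [l [u0 ur lm]]] := dihedral_eigenvector irr_rho rho_rm.
have l0 : l != 0.
  apply: contra_eq_neq lm => ->; rewrite expr0n (gtn_eqF m_gt0) eq_sym.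
  by rewrite oppr_eq0 oner_eq0.
pose v := u *m rho s; have us : u *m rho s = v by [].
have vs : v *m rho s = u.
  rewrite /v -mulmxA -repr_mxM //; case: gen_rs => _ s2 _ _ _.
  by rewrite -[(s * s)%g]/(s ^+ 2)%g s2 repr_mx1 mulmx1.
have vr : v *m rho r = l^-1 *: v.
  rewrite /v -mulmxA -repr_mxM // relation_sr repr_mxM ?groupV // mulmxA.
  rewrite scalemxAl; congr (_ *m _); apply: (scalerI l0).
  by rewrite scalerA mulfV // scale1r scalemxAl -ur -mulmxA -repr_mxM ?groupV //
    mulgV repr_mx1 mulmx1.
have rank_U (w : 'M_d) : mxmodule rho w -> w != 0 -> \rank w = d.
  by move=> mod_w w0; apply/eqP; apply: irrP.
have uv_full : \rank (u + v)%MS = d.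
  apply: rank_U.
    apply: dihedral_mxmodule.
      by rewrite addsmxMr ur vr addsmxS ?scalemx_sub.
    by rewrite addsmxMr -/v vs addsmxC.
  rewrite -mxrank_eq0 -lt0n; apply: leq_trans (mxrankS (addsmxSl u v)).
  by rewrite lt0n mxrank_eq0.
have d_le2 : (d <= 2)%N.
  rewrite -uv_full; apply: leq_trans (mxrank_adds_leqif u v) _.
  by apply: (@leq_add _ _ 1 1); apply: rank_leq_row.
move: d_gt0 d_le2 => {l0}.
case: d rho irr_rho rho_rm irrP u u0 l ur lm v us vs vr rank_U uv_full
  => [|[|[|//]]] // rho irr_rho rho_rm irrP u u0 l ur lm v us vs vr rank_U
  uv_full _ _.
  by have [] := dihedral_character_dim1 rho_rm; [constructor 1|constructor 2].
constructor 3.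
(* Otherwise r is the scalar -1, and u + v spans a line stable under r and s. *)
have lN1 : l != -1.
  apply/eqP=> lN1; pose w := u + v.
  have wr : w *m rho r = - w.
    by rewrite mulmxDl ur vr lN1 invrN1 !scaleN1r opprD.
  have ws : w *m rho s = w by rewrite mulmxDl us vs addrC.
  have [w0|w_neq0] := eqVneq w 0.
    have vu : (v <= u)%MS.
      have /eqP : v + u = 0 by rewrite addrC.
      by rewrite addr_eq0 => /eqP->; rewrite -scaleN1r scalemx_sub.
    have : (\rank (u + v)%MS <= \rank u)%N.
      by rewrite mxrankS // addsmx_sub submx_refl.
    by rewrite uv_full leqNgt ltnS rank_leq_row.
  have : \rank <<w>>%MS = 2.
    apply: rank_U; last by rewrite -mxrank_eq0 genmxE mxrank_eq0.
    by apply: dihedral_mxmodule;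
      rewrite (eqmxMr _ (genmxE w)) genmxE ?wr ?ws ?eqmx_opp.
  by rewrite genmxE => w2; have := rank_leq_row w; rewrite w2.
have [h [h_gt0 h_lt h_odd hE]] := primitive_root_odd_half lm lN1.
exists h; split=> // e j; rewrite /dihedral_mu hE.
pose P : 'M_2 := col_mx u v.
have uP : P \in unitmx.
  by rewrite -row_free_unit /row_free -(addsmxE u v) uv_full.
have uX := eigenvector_repr_expg j ur; have vX := eigenvector_repr_expg j vr.
case: e.
  pose M : 'M[k]_(1 + 1) := block_mx 0 (l^-1 ^+ j)%:M (l ^+ j)%:M 0.
  have <- : \tr M = 0 by rewrite mxtrace_block !mxtrace0 addr0.
  apply: (@mxtrace_conj _ _ P _ M) => //.
  rewrite expg1 repr_mxM ?groupX // /P (mul_col_mx u v).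
  rewrite -[RHS]/(@mulmx _ (1 + 1) (1 + 1) 2 M (col_mx u v)).
  rewrite mul_block_col !mul_scalar_mx.
  by rewrite !mul0mx add0r addr0 !mulmxA us vs uX vX.
pose M : 'M[k]_(1 + 1) := block_mx (l ^+ j)%:M 0 0 (l^-1 ^+ j)%:M.
have <- : \tr M = l ^+ j + l ^- j.
  by rewrite mxtrace_block !mxtrace_scalar !mulr1n exprVn.
apply: (@mxtrace_conj _ _ P _ M) => //.
rewrite expg0 mul1g /P (mul_col_mx u v).
rewrite -[RHS]/(@mulmx _ (1 + 1) (1 + 1) 2 M (col_mx u v)).
rewrite mul_block_col !mul_scalar_mx.
by rewrite !mul0mx add0r addr0 uX vX.
Qed.

End Dihedral.

(** * Conjugacy classes of PGL(2, q) *)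

(** Lagrange's theorem in the additive group of F. *)
Lemma natr_card_finField (F : finFieldType) : #|F|%:R = 0 :> F.
Proof. by rewrite -FinRing.zmodXgE -cardsT expg_cardG ?inE. Qed.

Lemma odd_finField_two_neq0 (F : finFieldType) : odd #|F| -> 2%:R != 0 :> F.
Proof.
move=> odd_q; apply/eqP=> two0; have := natr_card_finField F; apply/eqP.
rewrite -(odd_double_half #|F|) odd_q -muln2 natrD natrM two0.
by rewrite mulr0 addr0 oner_eq0.
Qed.

Section PGL2.

Variable F : finFieldType.
Implicit Types (A X : 'M[F]_2) (a b c d : F).

Lemma mx2M a b c d a' b' c' d' :
  mx2 a b c d *m mx2 a' b' c' d' =
  mx2 (a * a' + b * c') (a * b' + b * d') (c * a' + d * c') (c * b' + d * d').
Proof.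
apply/matrixP=> i j; rewrite !mxE !big_ord_recl big_ord0 addr0 !mxE /=.
by case: (i == 0); case: (j == 0).
Qed.

Lemma mx2Z t a b c d : t *: mx2 a b c d = mx2 (t * a) (t * b) (t * c) (t * d).
Proof.
by apply/matrixP=> i j; rewrite !mxE; case: (i == 0); case: (j == 0).
Qed.

Lemma mx2_1 : 1%:M = mx2 1 0 0 1 :> 'M[F]_2.
Proof.
apply/matrixP=> i j; rewrite !mxE.
by case: i j => [[|[|//]] ?] [[|[|//]] ?].
Qed.

Lemma pgl1 : pgl (1%:M : 'M[F]_2) = 1%g.
Proof.
by apply: (mulgI (pgl 1%:M)); rewrite -pglM ?unitmx1 // mulmx1 mulg1.
Qed.

(** The relation A X A = t X is an inverse-free form of X A X^-1 = A^-1 in PGL.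
*)
Lemma pgl_inverted A X t : A \in unitmx -> X \in unitmx -> t != 0 ->
  A *m X *m A = t *: X -> (pgl X * pgl A * (pgl X)^-1 = (pgl A)^-1)%g.
Proof.
move=> uA uX t0 E; apply: (mulgI (pgl A)).
rewrite mulgV !mulgA -!pglM ?unitmx_mul ?uA //.
apply/eqP; rewrite -eq_mulgV1 eq_sym; apply/eqP/pgl_eq => //.
  by rewrite !unitmx_mul uA uX.
by exists t.
Qed.

Lemma pgl_invol A : A \in unitmx -> (pgl A)^-1%g = pgl A ->
  exists t, A *m A = t%:M.
Proof.
move=> uA /(congr1 (mulg (pgl A))); rewrite mulgV -pglM // -pgl1.
case/pgl_eq; rewrite ?unitmx1 ?unitmx_mul ?uA // => t _ ->.
by exists t; rewrite scalemx1.
Qed.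

Lemma mx2_scalar a b c d t : mx2 a b c d = t%:M -> [/\ a = d, b = 0 & c = 0].
Proof.
rewrite -scalemx1 mx2_1 mx2Z => /matrixP E.
have := E 0 0; have := E 0 1; have := E 1 0; have := E 1 1.
by rewrite !mxE /= => -> -> -> ->; rewrite mulr0.
Qed.

Lemma unit_swap : (mx2 0 1 1 0 : 'M[F]_2) \in unitmx.
Proof. by rewrite unitmxE det_mx2 mul0r mul1r sub0r unitrN1. Qed.

Definition pgl_swap : coset_of (scalars F) := pgl (mx2 0 1 1 0).

Lemma pgl_c2X n : (pgl_c2 F ^+ n)%g = pgl (mx2 1 n%:R 0 1).
Proof.
elim: n => [|n IH]; first by rewrite expg0 -pgl1 mx2_1.
rewrite expgS IH -pglM ?unit_c2 //.
  by rewrite mx2M; congr (pgl (mx2 _ _ _ _)); rewrite -?natr1; ring.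
by rewrite unitmxE det_mx2 mulr0 subr0 mulr1 unitr1.
Qed.

Lemma pgl_c3X a n : a != 0 -> (pgl_c3 a ^+ n)%g = pgl_c3 (a ^+ n).
Proof.
move=> a0; elim: n => [|n IH]; first by rewrite expg0 -pgl1 mx2_1.
rewrite expgS IH -pglM ?unit_c3 ?expf_neq0 // /pgl_c3 mx2M.
by congr (pgl (mx2 _ _ _ _)); rewrite ?exprS; ring.
Qed.

Lemma pgl_c2_inverted :
  (pgl_c4 F * pgl_c2 F * (pgl_c4 F)^-1 = (pgl_c2 F)^-1)%g.
Proof.
apply: (@pgl_inverted _ _ 1); rewrite ?unit_c2 ?unit_c4 ?oner_eq0 //.
by rewrite !mx2M mx2Z; congr mx2; ring.
Qed.

Lemma pgl_c3_inverted a : a != 0 ->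
  (pgl_swap * pgl_c3 a * pgl_swap^-1 = (pgl_c3 a)^-1)%g.
Proof.
move=> a0; apply: (@pgl_inverted _ _ a); rewrite ?unit_c3 ?unit_swap //.
by rewrite !mx2M mx2Z; congr mx2; ring.
Qed.

Lemma pgl_c5_inverted (D x y : F) : (forall a, a ^+ 2 != D) -> x * y != 0 ->
  (pgl_c4 F * pgl_c5 D x y * (pgl_c4 F)^-1 = (pgl_c5 D x y)^-1)%g.
Proof.
move=> nsq xy; have := unit_c5 nsq xy.
rewrite unitmxE det_mx2 unitfE => det_neq0.
apply: (@pgl_inverted _ _ (x * x - D * y * y)); rewrite ?unit_c5 ?unit_c4 //.
by rewrite !mx2M mx2Z; congr mx2; ring.
Qed.

Hypothesis two_neq0 : 2%:R != 0 :> F.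

Lemma pgl_c2_neqV : ((pgl_c2 F)^-1 != pgl_c2 F)%g.
Proof.
apply/eqP=> /(pgl_invol (unit_c2 F))[t]; rewrite mx2M => /mx2_scalar[_ /eqP].
by rewrite !mulr1 (negPf two_neq0).
Qed.

Lemma pgl_c3_neqV a : a != 0 -> a != 1 -> a != -1 ->
  ((pgl_c3 a)^-1 != pgl_c3 a)%g.
Proof.
move=> a0 a1 aN1; apply/eqP=> /(pgl_invol (unit_c3 a0))[t].
rewrite mx2M => /mx2_scalar[/eqP]; rewrite !mulr0 addr0 add0r mulr1 -expr2.
by rewrite sqrf_eq1 (negPf a1) (negPf aN1).
Qed.

Lemma pgl_c5_neqV (D x y : F) : (forall a, a ^+ 2 != D) -> x * y != 0 ->
  ((pgl_c5 D x y)^-1 != pgl_c5 D x y)%g.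
Proof.
move=> nsq xy; apply/eqP=> /(pgl_invol (unit_c5 nsq xy))[t].
rewrite mx2M => /mx2_scalar[_ _ /eqP]; rewrite [y * x]mulrC -mulr2n -mulr_natl.
by rewrite mulf_eq0 (negPf two_neq0) (negPf xy).
Qed.

End PGL2.
(** An involution acts on V by 1 or -1, and finite dimension excludes 1. *)
Lemma dihedral_centralizer_character (k : closedFieldType)
    (gT : finGroupType) (G : {group gT}) (m : nat) (g r s : gT) (z : k)
    (d : nat) (rho : mx_representation k 'C_G[g]%g d) :
    [pchar k] =i pred0 -> g \in G -> (0 < m)%N ->
    dihedral_generators 'C_G[g]%g m.*2 r s -> g = (r ^+ m)%g ->
    m.*2.-primitive_root z ->
    mx_irreducible rho -> finite_dimensional (nichols rho) ->
  [\/ has_dihedral_character rho r s (@dihedral_chi3 k),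
      has_dihedral_character rho r s (@dihedral_chi4 k)
    | exists h : nat, [/\ (0 < h)%N, (h.*2 < m.*2)%N, odd h
        & has_dihedral_character rho r s (dihedral_mu z h)]].
Proof.
move=> char_k Gg m_gt0 gens g_rm prim_z irr_rho fin_dim.
have g2 : (g ^+ 2 = 1)%g by case: gens => rn _ _ _ _; rewrite g_rm -expgM muln2.
have rho_g := involution_finite_dimensional char_k Gg irr_rho g2 fin_dim.
apply: (dihedral_irr_character char_k m_gt0 gens prim_z irr_rho).
by rewrite -g_rm.
Qed.

Theorem theorem1p5 (k : closedFieldType) (F : finFieldType) (Delta : F)
    (char_k : [pchar k] =i pred0) (odd_q : odd #|F|)
    (nonsquare_Delta : forall a : F, a ^+ 2 != Delta) :
  [/\ type_B k (PGL2 F) (pgl_c2 F),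
      (#|F| %% 4 = 1)%N ->
      forall x : {unit F}, val x != 1 -> val x != -1 ->
      forall (d : nat)
        (rho : mx_representation k 'C_(PGL2 F)[pgl_c3 (val x)]%g d),
      mx_irreducible rho -> finite_dimensional (nichols rho) ->
      ~~ odd #[x]%g /\ rho (pgl_c3 (val x)) = (-1)%:M,
      (#|F| %% 4 = 3)%N ->
      forall (d : nat) (rho : mx_representation k 'C_(PGL2 F)[pgl_c4 F]%g d)
        (r s : coset_of (scalars F)) (z : k),
      dihedral_generators 'C_(PGL2 F)[pgl_c4 F]%g #|F|.-1 r s ->
      pgl_c4 F = (r ^+ (#|F|.-1)./2)%g ->
      (#|F|.-1).-primitive_root z ->
      mx_irreducible rho -> finite_dimensional (nichols rho) ->
      [\/ has_dihedral_character rho r s (@dihedral_chi3 k),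
          has_dihedral_character rho r s (@dihedral_chi4 k)
        | exists h : nat, [/\ (0 < h)%N, (h.*2 < #|F|.-1)%N, odd h
            & has_dihedral_character rho r s (dihedral_mu z h)]],
      (#|F| %% 4 = 3)%N ->
      forall x y : F, x * y != 0 ->
      forall (d : nat)
        (rho : mx_representation k 'C_(PGL2 F)[pgl_c5 Delta x y]%g d),
      mx_irreducible rho -> finite_dimensional (nichols rho) ->
      ~~ odd #[pgl_c5 Delta x y]%g /\ rho (pgl_c5 Delta x y) = (-1)%:M
    & (#|F| %% 4 = 1)%N ->
      forall (d : nat) (rho : mx_representation k 'C_(PGL2 F)[pgl_c6 Delta]%g d)
        (r s : coset_of (scalars F)) (z : k),
      dihedral_generators 'C_(PGL2 F)[pgl_c6 Delta]%g #|F|.+1 r s ->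
      pgl_c6 Delta = (r ^+ (#|F|.+1)./2)%g ->
      (#|F|.+1).-primitive_root z ->
      mx_irreducible rho -> finite_dimensional (nichols rho) ->
      [\/ has_dihedral_character rho r s (@dihedral_chi3 k),
          has_dihedral_character rho r s (@dihedral_chi4 k)
        | exists h : nat, [/\ (0 < h)%N, (h.*2 < #|F|.+1)%N, odd h
            & has_dihedral_character rho r s (dihedral_mu z h)]]].
Proof.
have two_neq0 := odd_finField_two_neq0 odd_q.
split.
- move=> d rho irr_rho fin_dim.
  have rho_g := real_class_finite_dimensional char_k (pgl_in _) irr_rho
    (pgl_in _)
    (pgl_c2_inverted F) (pgl_c2_neqV two_neq0) fin_dim.
  have c2_q : (pgl_c2 F ^+ #|F| = 1)%g.
    by rewrite pgl_c2X natr_card_finField -mx2_1 pgl1.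
  by have := repr_opp1_even char_k (pgl_in _) irr_rho rho_g c2_q; rewrite odd_q.
- move=> _ x x1 xN1 d rho irr_rho fin_dim.
  have x0 : val x != 0 by rewrite -unitfE (valP x).
  have rho_g := real_class_finite_dimensional char_k (pgl_in _) irr_rho
    (pgl_in _)
    (pgl_c3_inverted x0) (pgl_c3_neqV x0 x1 xN1) fin_dim.
  split=> //; apply: (repr_opp1_even char_k (pgl_in _) irr_rho rho_g).
  rewrite pgl_c3X // -FinRing.val_unitX expg_order FinRing.val_unit1.
  by rewrite /pgl_c3 -mx2_1 pgl1.
- move=> _ d rho r s z; have -> : (#|F|.-1 = (#|F|.-1)./2.*2)%N.
    rewrite -[LHS]odd_double_half -subn1 oddB ?odd_q //.
    by rewrite ltnW // card_finNzRing_gt1.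
  rewrite doubleK; apply: dihedral_centralizer_character => //.
    exact: pgl_in.
  by have := card_finNzRing_gt1 F; move: odd_q; case: #|F| => [|[|[|n]]].
- move=> _ x y xy d rho irr_rho fin_dim.
  have rho_g := real_class_finite_dimensional char_k (pgl_in _) irr_rho
    (pgl_in _)
    (pgl_c5_inverted nonsquare_Delta xy)
    (pgl_c5_neqV two_neq0 nonsquare_Delta xy) fin_dim.
  split=> //; apply: (repr_opp1_even char_k (pgl_in _) irr_rho rho_g).
  exact: expg_order.
move=> _ d rho r s z; have -> : (#|F|.+1 = (#|F|.+1)./2.*2)%N.
  by rewrite -[LHS]odd_double_half /= odd_q.
rewrite doubleK; apply: dihedral_centralizer_character => //.
  exact: pgl_in.
by have := card_finNzRing_gt1 F; case: #|F|.
Qed.
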